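(* Let $k\geq 1$ be a natural number and let $R$ be a commutative ring containing units $q_0,q,\lambda$ and further elements $A_0,\ldots,A_{k-1},q_1,\ldots,q_{k-1}$ such that $\lambda-\lambda^{-1}=\delta(1-A_0)$, where $\delta=q-q^{-1}$, and suppose $\delta$ is not a zero divisor in $R$. The following are equivalent: (1) $\mathscr{B}_2^k(R)$ is a free $R$-module of rank $3k^2$. (2) The set $\{Y^ie\mid 0\le i\le k-1\}$ is linearly independent over $R$ in $\mathscr{B}_2^k(R)$. (3) $\mathscr{B}_2^k(R)$ admits a module which is free over $R$ of rank $k$, with an $R$-basis $v_0,\ldots,v_{k-1}$ on which the actions of $Y$, $X$ and $e$ are described by $$Yv_i=v_{i+1}\quad(0\le i\le k-2),\qquad Yv_{k-1}=\sum_{i=0}^{k-1}q_iv_i,$$ $$Xv_0=\lambda v_0,\qquad Xv_1=\lambda^{-1}Y^{-1}v_0,$$ $$Xv_i=Y^{-1}Xv_{i-1}-\delta v_{i-2}+\delta A_{i-1}Y^{-1}v_0\quad(2\le i\le k-1),$$ $$ev_i=A_iv_0\quad(0\le i\le k-1),$$ where $v_s:=Y^sv_0$ for every integer $s$ (so that $v_1=Yv_0$ also when $k=1$). (4) The parameters $(A_0,\ldots,A_{k-1},q_0,\ldots,q_{k-1},q,\lambda)$ of $R$ are admissible.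
   Context: Put $q_k:=-1$. The algebra. $\mathscr{B}_2^k(R)$ is the unital associative $R$-algebra generated by $Y^{\pm1},X^{\pm1},e$ subject to: $Y^k=\sum_{i=0}^{k-1}q_iY^i$; $X-X^{-1}=\delta(1-e)$; $XYXY=YXYX$; $Xe=\lambda e=eX$; $YXYe=\lambda^{-1}e=eYXY$; $eY^me=A_me$ for $0\le m\le k-1$. Modules are left modules. Admissibility. Write $k=2z-\epsilon$ with $z=\lceil k/2\rceil$, so $\epsilon=0$ if $k$ is even and $\epsilon=1$ if $k$ is odd. Set $$\beta=q_0\lambda-q_0^{-1}\lambda^{-1}+(1-\epsilon)\delta,$$ and for $1\le l\le k-1$, $$h_l=\lambda^{-1}(q_l+q_0^{-1}q_{k-l})+\delta\left[\sum_{r=1}^{k-l}q_{r+l}A_r-\sum_{i=\max(l+1,z)}^{\lfloor (l+k)/2\rfloor}q_{2i-l}+\sum_{i=\lceil l/2\rceil}^{\min(l,z-1)}q_{2i-l}\right]$$ (empty sums are $0$). The parameters are called admissible if $\lambda-\lambda^{-1}=\delta(1-A_0)$ and $h_1=\cdots=h_{k-1}=\beta=0$. *)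

(* Defs.v *)
From HB Require Import structures.
From mathcomp Require Import all_boot all_order all_algebra.
From mathcomp Require Import boolp.

Set Implicit Arguments.
Unset Strict Implicit.
Unset Printing Implicit Defensive.

Import GRing.Theory.
Local Open Scope ring_scope.
Local Open Scope quotient_scope.

(* Unital associative R-algebras given by generators and relations: formal    *)
(* algebra expressions modulo the least congruence that contains the algebra  *)
(* axioms and the given relations.                                            *)

Section PresentedAlgebra.
Variables (R : comPzRingType) (G : Type).

Inductive term : Type :=
| Gen of G
| Const of R
| Add of term & term
| Mul of term & term.

HB.instance Definition _ := gen_eqMixin term.
HB.instance Definition _ := gen_choiceMixin term.

Variable rel : term -> term -> Prop.

Inductive cong : term -> term -> Prop :=
| cong_rel t u of rel t u : cong t u
| cong_refl t : cong t t
| cong_sym t u of cong t u : cong u t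
| cong_trans t u v of cong t u & cong u v : cong t v
| cong_add t t' u u' of cong t t' & cong u u' : cong (Add t u) (Add t' u')
| cong_mul t t' u u' of cong t t' & cong u u' : cong (Mul t u) (Mul t' u')
| cong_addA t u v : cong (Add t (Add u v)) (Add (Add t u) v)
| cong_addC t u : cong (Add t u) (Add u t)
| cong_add0 t : cong (Add (Const 0) t) t
| cong_mulA t u v : cong (Mul t (Mul u v)) (Mul (Mul t u) v)
| cong_mul1 t : cong (Mul (Const 1) t) t
| cong_mul0 t : cong (Mul (Const 0) t) (Const 0)
| cong_mulDl t u v : cong (Mul (Add t u) v) (Add (Mul t v) (Mul u v))
| cong_mulDr t u v : cong (Mul t (Add u v)) (Add (Mul t u) (Mul t v))
| cong_constD a b : cong (Const (a + b)) (Add (Const a) (Const b))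
| cong_constM a b : cong (Const (a * b)) (Mul (Const a) (Const b))
| cong_constC a t : cong (Mul (Const a) t) (Mul t (Const a)).

Definition congb : ssrbool.rel term := fun t u => `[< cong t u >].

Lemma congb_refl : reflexive congb.
Proof. by move=> t; apply/asboolP; apply: cong_refl. Qed.

Lemma congb_sym : symmetric congb.
Proof. by move=> t u; apply/asboolP/asboolP; apply: cong_sym. Qed.

Lemma congb_trans : transitive congb.
Proof.
move=> u t v /asboolP tu /asboolP uv; apply/asboolP.
exact: cong_trans tu uv.
Qed.

Canonical congb_equiv := EquivRel congb congb_refl congb_sym congb_trans.

Definition presented_alg : Type := {eq_quot congb}.
HB.instance Definition _ := Choice.on presented_alg.
HB.instance Definition _ := EqQuotient.on presented_alg.

Definition pclass (t : term) : presented_alg := \pi_presented_alg t.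

Lemma pclassP t u : (pclass t = pclass u) <-> cong t u.
Proof.
split; first by move/eqquotP/asboolP.
by move=> tu; apply/eqquotP/asboolP.
Qed.

Lemma pclass_repr (x : presented_alg) : pclass (repr x) = x.
Proof. exact: reprK. Qed.

Lemma cong_repr t : cong (repr (pclass t)) t.
Proof. by apply/pclassP; rewrite pclass_repr. Qed.

Definition padd (x y : presented_alg) := pclass (Add (repr x) (repr y)).
Definition pmul (x y : presented_alg) := pclass (Mul (repr x) (repr y)).
Definition pconst (a : R) := pclass (Const a).
Definition pgen (g : G) := pclass (Gen g).

Lemma pclassD t u : pclass (Add t u) = padd (pclass t) (pclass u).
Proof. by apply/pclassP/cong_sym; apply: cong_add; apply: cong_repr. Qed.

Lemma pclassM t u : pclass (Mul t u) = pmul (pclass t) (pclass u).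
Proof. by apply/pclassP/cong_sym; apply: cong_mul; apply: cong_repr. Qed.

Lemma pclassW (P : presented_alg -> Prop) :
  (forall t, P (pclass t)) -> forall x, P x.
Proof. by move=> Pt x; rewrite -[x]pclass_repr. Qed.

Lemma paddA : associative padd.
Proof.
elim/pclassW => t; elim/pclassW => u; elim/pclassW => v.
by rewrite -!pclassD; apply/pclassP/cong_addA.
Qed.

Lemma paddC : commutative padd.
Proof.
elim/pclassW => t; elim/pclassW => u.
by rewrite -!pclassD; apply/pclassP/cong_addC.
Qed.

Lemma padd0 : left_id (pconst 0) padd.
Proof. by elim/pclassW => t; rewrite -pclassD; apply/pclassP/cong_add0. Qed.

Lemma pmulA : associative pmul.
Proof.
elim/pclassW => t; elim/pclassW => u; elim/pclassW => v.
by rewrite -!pclassM; apply/pclassP/cong_mulA.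
Qed.

Lemma pconstC a x : pmul (pconst a) x = pmul x (pconst a).
Proof.
by move: x; elim/pclassW => t; rewrite -!pclassM; apply/pclassP/cong_constC.
Qed.

Lemma pmul1 : left_id (pconst 1) pmul.
Proof. by elim/pclassW => t; rewrite -pclassM; apply/pclassP/cong_mul1. Qed.

Lemma pmulr1 : right_id (pconst 1) pmul.
Proof. by move=> x; rewrite -pconstC pmul1. Qed.

Lemma pmul0 x : pmul (pconst 0) x = pconst 0.
Proof.
by move: x; elim/pclassW => t; rewrite -pclassM; apply/pclassP/cong_mul0.
Qed.

Lemma pmulDl : left_distributive pmul padd.
Proof.
elim/pclassW => t; elim/pclassW => u; elim/pclassW => v.
by rewrite -!(pclassM, pclassD); apply/pclassP/cong_mulDl.
Qed.

Lemma pmulDr : right_distributive pmul padd.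
Proof.
elim/pclassW => t; elim/pclassW => u; elim/pclassW => v.
by rewrite -!(pclassM, pclassD); apply/pclassP/cong_mulDr.
Qed.

Lemma pconstD a b : pconst (a + b) = padd (pconst a) (pconst b).
Proof. by rewrite -pclassD; apply/pclassP/cong_constD. Qed.

Lemma pconstM a b : pconst (a * b) = pmul (pconst a) (pconst b).
Proof. by rewrite -pclassM; apply/pclassP/cong_constM. Qed.

Definition popp x := pmul (pconst (-1)) x.

Lemma paddN : left_inverse (pconst 0) popp padd.
Proof.
by move=> x; rewrite -{2}[x]pmul1 -pmulDl -pconstD addNr pmul0.
Qed.

HB.instance Definition _ :=
  GRing.isZmodule.Build presented_alg paddA paddC padd0 paddN.
HB.instance Definition _ :=
  GRing.Zmodule_isPzRing.Build presented_alg pmulA pmul1 pmulr1 pmulDl pmulDr.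

Definition pscale (a : R) (x : presented_alg) := pmul (pconst a) x.

Lemma pscaleA a b x : pscale a (pscale b x) = pscale (a * b) x.
Proof. by rewrite /pscale pmulA -pconstM. Qed.

Lemma pscaleDr : right_distributive pscale +%R.
Proof. by move=> a x y; apply: pmulDr. Qed.

Lemma pscaleDl x : {morph pscale^~ x : a b / a + b}.
Proof. by move=> a b; rewrite /pscale pconstD pmulDl. Qed.

(* There is no algType instance: that structure requires 1 != 0, which fails  *)
(* for some relations. The two algebra axioms are pscalerAl and pscalerAr.    *)
HB.instance Definition _ := GRing.Zmodule_isLmodule.Build R presented_alg
  pscaleA pmul1 pscaleDr pscaleDl.

Lemma pscalerAl (a : R) (x y : presented_alg) : a *: (x * y) = (a *: x) * y.
Proof. exact: pmulA. Qed.

Lemma pscalerAr (a : R) (x y : presented_alg) : a *: (x * y) = x * (a *: y).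
Proof.
by rewrite pscalerAl; change (pmul (pmul (pconst a) x) y = pmul x (pmul (pconst a) y));
  rewrite pmulA (pconstC a x).
Qed.

Lemma pconstE (a : R) : pconst a = a *: (1 : presented_alg).
Proof. by rewrite -[LHS]pmulr1. Qed.

Section Lift.
Variables (S : pzRingType) (phi : {rmorphism R -> S}) (f : G -> S).
Hypothesis phiC : forall a x, phi a * x = x * phi a.

Fixpoint term_eval (t : term) : S :=
  match t with
  | Gen g => f g
  | Const a => phi a
  | Add t u => term_eval t + term_eval u
  | Mul t u => term_eval t * term_eval u
  end.

Hypothesis frel : forall t u, rel t u -> term_eval t = term_eval u.

Lemma cong_eval t u : cong t u -> term_eval t = term_eval u.
Proof.
elim=> {t u} //=.
- by move=> t u v _ -> _ ->.
- by move=> t t' u u' _ -> _ ->.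
- by move=> t t' u u' _ -> _ ->.
- by move=> t u v; rewrite addrA.
- by move=> t u; rewrite addrC.
- by move=> t; rewrite rmorph0 add0r.
- by move=> t u v; rewrite mulrA.
- by move=> t; rewrite rmorph1 mul1r.
- by move=> t; rewrite rmorph0 mul0r.
- by move=> t u v; rewrite mulrDl.
- by move=> t u v; rewrite mulrDr.
- by move=> a b; rewrite rmorphD.
- by move=> a b; rewrite rmorphM.
Qed.

Lemma presented_alg_lift : exists F : {rmorphism presented_alg -> S},
  (forall a x, F (a *: x) = phi a * F x) /\ (forall g, F (pgen g) = f g).
Proof.
pose F0 (x : presented_alg) := term_eval (repr x).
have F0E t : F0 (pclass t) = term_eval t by apply/cong_eval/cong_repr.
have F0D : {morph F0 : x y / x + y}.
  elim/pclassW => t; elim/pclassW => u.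
  by rewrite -[pclass t + _]pclassD !F0E.
have F0M : {morph F0 : x y / x * y}.
  elim/pclassW => t; elim/pclassW => u.
  by rewrite -[pclass t * _]pclassM !F0E.
have F00 : F0 0 = 0 by rewrite [LHS]F0E /= rmorph0.
have F01 : F0 1 = 1 by rewrite [LHS]F0E /= rmorph1.
pose zm := GRing.isNmodMorphism.Build presented_alg S F0 (conj F00 F0D).
pose rm := GRing.isMonoidMorphism.Build presented_alg S F0 (conj F01 F0M).
pose F : {rmorphism presented_alg -> S} := HB.pack F0 zm rm.
exists F; split=> [a|g]; last by rewrite [LHS]F0E.
elim/pclassW => t.
by rewrite -[a *: _](pclassM (Const a) t) [LHS]F0E [X in _ * X]F0E.
Qed.

Lemma presented_alg_lift_uniq (F F' : {rmorphism presented_alg -> S}) :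
  (forall a x, F (a *: x) = phi a * F x) ->
  (forall a x, F' (a *: x) = phi a * F' x) ->
  (forall g, F (pgen g) = F' (pgen g)) -> F =1 F'.
Proof.
move=> Fc F'c Fg; elim/pclassW; elim=> [g|a|t IHt u IHu|t IHt u IHu].
- exact: Fg.
- by rewrite -/(pconst a) pconstE Fc F'c !rmorph1.
- by rewrite pclassD -/(pclass t + pclass u) !rmorphD IHt IHu.
- by rewrite pclassM -/(pclass t * pclass u) !rmorphM IHt IHu.
Qed.
End Lift.

(* Restriction of scalars along R -> presented_alg, a |-> a *: 1. *)
Definition restr (V : lmodType presented_alg) : Type := V.
Section Restr.
Variable V : lmodType presented_alg.
HB.instance Definition _ := GRing.Zmodule.on (restr V).

Definition rscale (a : R) (x : restr V) : restr V :=
  (a *: (1 : presented_alg)) *: (x : V).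

Lemma rscaleA a b x : rscale a (rscale b x) = rscale (a * b) x.
Proof. by rewrite /rscale scalerA -pscalerAl mul1r scalerA. Qed.
Lemma rscale1 : left_id 1 rscale.
Proof. by move=> x; rewrite /rscale !scale1r. Qed.
Lemma rscaleDr : right_distributive rscale +%R.
Proof. by move=> a x y; apply: scalerDr. Qed.
Lemma rscaleDl x : {morph rscale^~ x : a b / a + b}.
Proof. by move=> a b; rewrite /rscale !scalerDl. Qed.

HB.instance Definition _ := GRing.Zmodule_isLmodule.Build R (restr V)
  rscaleA rscale1 rscaleDr rscaleDl.

Definition act (b : presented_alg) (x : restr V) : restr V := b *: (x : V).
End Restr.

End PresentedAlgebra.

Section Bases.
Variables (R : pzRingType) (M : lmodType R) (n : nat).

Definition lin_indep (b : 'I_n -> M) : Prop :=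
  forall c : 'I_n -> R, \sum_(i < n) c i *: b i = 0 -> forall i, c i = 0.

Definition spanning (b : 'I_n -> M) : Prop :=
  forall x : M, exists c : 'I_n -> R, x = \sum_(i < n) c i *: b i.

Definition is_basis (b : 'I_n -> M) : Prop := lin_indep b /\ spanning b.

Definition free_of_rank : Prop := exists b : 'I_n -> M, is_basis b.
End Bases.

Section BMW.
Variables (R : comUnitRingType) (k : nat) (q lambda : R) (q_ A : nat -> R).
(* Of the sequences q_ and A only the entries of index < k are used. *)

Definition delta : R := q - q^-1.

(* The convention q_k = -1 used in the admissibility conditions *)
Definition qx (i : nat) : R := if i == k then -1 else q_ i.

Definition beta : R :=
  q_ 0 * lambda - (q_ 0)^-1 * lambda^-1 + (~~ odd k)%:R * delta.

Definition hl (l : nat) : R :=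
  let z := uphalf k in
  lambda^-1 * (q_ l + (q_ 0)^-1 * q_ (k - l)%N)
  + delta * (\sum_(1 <= r < (k - l).+1) qx (r + l) * A r
             - \sum_(maxn l.+1 z <= i < ((l + k)./2).+1) qx (2 * i - l)
             + \sum_(uphalf l <= i < (minn l z.-1).+1) qx (2 * i - l)).

Definition admissible : Prop :=
  [/\ lambda - lambda^-1 = delta * (1 - A 0),
      forall l, (1 <= l <= k.-1)%N -> hl l = 0
    & beta = 0].

Inductive bmw_gen := GY | GYi | GX | GXi | Ge.

Local Notation T := (term R bmw_gen).
Local Notation "''[' g ]" := (Gen R g) (at level 0).
Local Notation "t +t u" := (@Add R bmw_gen t u) (at level 50, left associativity).
Local Notation "t *t u" := (@Mul R bmw_gen t u) (at level 40, left associativity).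
Local Notation cst := (@Const R bmw_gen).
Definition tpow (t : T) (n : nat) : T := iter n (fun u => t *t u) (cst 1).

Inductive bmw_rel : T -> T -> Prop :=
| rel_YYi : bmw_rel ('[GY] *t '[GYi]) (cst 1)
| rel_YiY : bmw_rel ('[GYi] *t '[GY]) (cst 1)
| rel_XXi : bmw_rel ('[GX] *t '[GXi]) (cst 1)
| rel_XiX : bmw_rel ('[GXi] *t '[GX]) (cst 1)
| rel_Yk : bmw_rel (tpow '[GY] k)
    (\big[@Add R bmw_gen/cst 0]_(i < k) (cst (q_ i) *t tpow '[GY] i))
| rel_skein : bmw_rel ('[GX] +t cst (-1) *t '[GXi])
    (cst delta *t (cst 1 +t cst (-1) *t '[Ge]))
| rel_braid : bmw_rel ('[GX] *t '[GY] *t '[GX] *t '[GY])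
    ('[GY] *t '[GX] *t '[GY] *t '[GX])
| rel_Xe : bmw_rel ('[GX] *t '[Ge]) (cst lambda *t '[Ge])
| rel_eX : bmw_rel ('[Ge] *t '[GX]) (cst lambda *t '[Ge])
| rel_YXYe : bmw_rel ('[GY] *t '[GX] *t '[GY] *t '[Ge]) (cst lambda^-1 *t '[Ge])
| rel_eYXY : bmw_rel ('[Ge] *t '[GY] *t '[GX] *t '[GY]) (cst lambda^-1 *t '[Ge])
| rel_eYe m of (m < k)%N :
    bmw_rel ('[Ge] *t tpow '[GY] m *t '[Ge]) (cst (A m) *t '[Ge]).

Definition BMW2 : Type := presented_alg bmw_rel.
HB.instance Definition _ := GRing.PzRing.on BMW2.
HB.instance Definition _ := GRing.Lmodule.on BMW2.

Definition bY : BMW2 := pgen bmw_rel GY.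
Definition bYi : BMW2 := pgen bmw_rel GYi.
Definition bX : BMW2 := pgen bmw_rel GX.
Definition bXi : BMW2 := pgen bmw_rel GXi.
Definition be : BMW2 := pgen bmw_rel Ge.

Lemma BMW2_rel :
  [/\ [/\ bY * bYi = 1, bYi * bY = 1, bX * bXi = 1 & bXi * bX = 1],
      bY ^+ k = \sum_(i < k) q_ i *: bY ^+ i,
      bX - bXi = delta *: (1 - be),
      bX * bY * bX * bY = bY * bX * bY * bX &
  [/\ bX * be = lambda *: be, be * bX = lambda *: be,
      bY * bX * bY * be = lambda^-1 *: be,
      be * bY * bX * bY = lambda^-1 *: be &
      forall m, (m < k)%N -> be * bY ^+ m * be = A m *: be]].
Proof.
pose pc := pclass bmw_rel.
have relE t u : bmw_rel t u -> pc t = pc u by move=> tu; apply/pclassP/cong_rel.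
have D t u : pc (t +t u) = pc t + pc u := pclassD _ t u.
have M t u : pc (t *t u) = pc t * pc u := pclassM _ t u.
have Z a t : pc (cst a *t t) = a *: pc t := pclassM _ _ t.
have N t : pc (cst (-1) *t t) = - pc t := pclassM _ _ t.
have pow t n : pc (tpow t n) = pc t ^+ n.
  by elim: n => [|n IHn] //=; rewrite M IHn exprS.
have one : pc (cst 1) = 1 by [].
rewrite /bY /bYi /bX /bXi /be /pgen -/pc; split; [split|..|split].
- by rewrite -M (relE _ _ rel_YYi).
- by rewrite -M (relE _ _ rel_YiY).
- by rewrite -M (relE _ _ rel_XXi).
- by rewrite -M (relE _ _ rel_XiX).
- rewrite -pow (relE _ _ rel_Yk) (big_morph pc D (erefl : pc (cst 0) = 0)).
  by apply: eq_bigr => i _; rewrite Z pow.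
- by rewrite -N -D (relE _ _ rel_skein) Z D N.
- by have := relE _ _ rel_braid; rewrite !M.
- by have := relE _ _ rel_Xe; rewrite Z M.
- by have := relE _ _ rel_eX; rewrite Z M.
- by have := relE _ _ rel_YXYe; rewrite Z !M.
- by have := relE _ _ rel_eYXY; rewrite Z !M.
- by move=> m mk; have := relE _ _ (rel_eYe mk); rewrite Z !M pow.
Qed.

Definition bYpow (s : int) : BMW2 :=
  match s with Posz n => bY ^+ n | Negz n => bYi ^+ n.+1 end.

End BMW.

(* Main.v *)
Require Import Defs.
From HB Require Import structures.
From mathcomp Require Import all_boot all_order all_algebra.
From mathcomp Require Import boolp qpoly ring zify.

Set Implicit Arguments.
Unset Strict Implicit.
Unset Printing Implicit Defensive.

Import GRing.Theory.
Local Open Scope ring_scope.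

(** Put f(t) = t^k - q_(k-1) t^(k-1) - ... - q_0 and S = R[t]/(f), and let y be
    the class of t, which is invertible because q_0 is a unit.  Write d for
    delta, and p(Y) for the value at Y of an element p of S.

    The element XYXY commutes with X and Y and fixes e, so YXY acts on the left
    ideal Be as X^-1 = X - d + d e.  This determines X on Be: X p(Y) e is
    xi(p)(Y) e for the R-linear map xi on S with xi(y^m) = x_m for m < k, where
    x_0 = lambda and x_(m+1) = y^-1 (x_m - d y^m + d A_m) [Xcoord, X_evalY_e].
    The same rule at m + 1 = k gives a second value x_k for the sum of the
    q_i x_i.  Each of the four statements is equivalent to the recurrence
      q_0 x_0 + ... + q_(k-1) x_(k-1) = x_k.

    For (4): expanded in 1, y^-1, ..., y^-(k-1), a basis of S, the difference of
    the two sides is beta + h_1 y^-1 + ... + h_(k-1) y^-(k-1) [Xcoord_defect].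

    (3) implies the recurrence, since X Y v_(k-1) can be computed from the
    expansion of Y v_(k-1) and also from XYXY = 1 [module_recurrence].

    (2) implies (3): independence says that p |-> p(Y) e is a bijection from S
    to the left ideal Be, and Be is the required module
    [module_of_independence].

    (1) implies (2): the 3k^2 elements Y^i X Y^j, X Y^i X Y^j and Y^i e Y^j span
    B [brick_spanning], and a spanning family of n elements in a free module of
    rank n is independent [spanning_lin_indep].

    (4) implies (1): these 3k^2 elements have to be shown independent.  Let X, Y
    and e act on S by xi, y and p |-> A(p) 1, where A(y^i) = A_i.  The recurrence
    gives YXY = X - d + d e on S.  The two relations that remain open, eX =
    lambda e and XYXY = 1, are tied together: if g(p) is the defect
    A(xi p) - lambda A(p) of the first, then W = XYXY satisfies
    W(yp) = y W(p) - d g(yp).  Applying this to f(y) = 0 gives d g = 0, so both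
    relations hold as d is regular [efun_Xop, Xop_y_Xop_y].  Next, left
    multiplication by Y, X and e on p(Y) X, X p(Y) X and p(Y) e is expressed by
    xi and A alone, with right multiplication by Y as a scalar.  The resulting
    formulas define matrices over S of size 3k, and these satisfy all the
    relations [representation].  The vector that stands for 1 is sent by the
    3k^2 elements to an R-independent family [brick_basis_free]. *)

(** * Linear algebra over a commutative ring *)

Section Semilinear.
Variables (R : pzRingType) (U : lmodType R).

(** The scaling s is a parameter because the maps out of S below take values in
    R-modules, in R itself, and in S-modules on which R acts through r%:A. *)
Definition semilin (W : zmodType) (s : R -> W -> W) (F : U -> W) : Prop :=
  (forall p p', F (p + p') = F p + F p') /\ (forall r p, F (r *: p) = s r (F p)).

Variables (W : zmodType) (s : R -> W -> W).
Hypothesis sD : forall r, {morph s r : v w / v + w}.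

Lemma semilin_sum F I (r : seq I) (P : pred I) (E : I -> U) : semilin s F ->
  F (\sum_(i <- r | P i) E i) = \sum_(i <- r | P i) F (E i).
Proof.
move=> [FD _]; have F0 : F 0 = 0 by apply: (addrI (F 0)); rewrite -FD !addr0.
exact: (big_morph F FD F0).
Qed.

Lemma semilinD F G : semilin s F -> semilin s G -> semilin s (fun p => F p + G p).
Proof.
by move=> [FD FZ] [GD GZ]; split=> [p p'|r p]; rewrite ?FD ?GD ?FZ ?GZ ?sD // addrACA.
Qed.

Lemma semilin_comp (W' : zmodType) (s' : R -> W' -> W') (h : W -> W') F :
  {morph h : v w / v + w} -> (forall r v, h (s r v) = s' r (h v)) ->
  semilin s F -> semilin s' (fun p => h (F p)).
Proof. by move=> hD hs [FD FZ]; split=> [p p'|r p]; rewrite ?FD ?FZ ?hD ?hs. Qed.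

Lemma semilinN F : semilin s F -> semilin s (fun p => - F p).
Proof.
have sN r v : s r (- v) = - s r v.
  have s0 : s r 0 = 0 by apply: (addrI (s r 0)); rewrite -sD !addr0.
  by apply: (addrI (s r v)); rewrite -sD !subrr s0.
by move=> FL; apply: (semilin_comp (h := fun v => - v) _ _ FL) => [v w|r v]; rewrite ?opprD ?sN.
Qed.

Lemma semilin_pre F (L : U -> U) : semilin *:%R L -> semilin s F -> semilin s (fun p => F (L p)).
Proof. by move=> [LD LZ] [FD FZ]; split=> [p p'|r p]; rewrite ?LD ?LZ ?FD ?FZ. Qed.

End Semilinear.

Section Families.
Variables (R : comNzRingType) (M : lmodType R).

(** Expressing a basis by the family and the family by the basis gives square
    matrices with P Q = 1, and then Q P = 1 because R is commutative. *)
Lemma spanning_lin_indep n (b : 'I_n -> M) :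
  free_of_rank M n -> spanning b -> lin_indep b.
Proof.
move=> [u [u_free u_span]] b_span.
have [P uE] := fin_all_exists (fun i => b_span (u i)).
have [Q bE] := fin_all_exists (fun j => u_span (b j)).
have sumE (c : 'I_n -> R) :
    \sum_j c j *: b j = \sum_i (\sum_j c j * Q j i) *: u i.
  under eq_bigr do rewrite bE scaler_sumr.
  rewrite exchange_big; apply: eq_bigr => i _; rewrite scaler_suml.
  by apply: eq_bigr => j _; rewrite scalerA.
pose Pm : 'M[R]_n := \matrix_(i, j) P i j.
pose Qm : 'M[R]_n := \matrix_(i, j) Q i j.
have PQ1 : Pm *m Qm = 1%:M.
  apply/matrixP => i l; apply/eqP; rewrite -subr_eq0; apply/eqP; move: l.
  apply: u_free; under eq_bigr do rewrite !mxE scalerBl.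
  rewrite sumrB; apply/eqP; rewrite subr_eq0; apply/eqP.
  transitivity (u i); last first.
    rewrite (bigD1 i) //= eqxx scale1r big1 ?addr0 // => j /negPf.
    by rewrite eq_sym => ->; rewrite scale0r.
  rewrite [RHS]uE sumE; apply: eq_bigr => l _; congr (_ *: _).
  by apply: eq_bigr => j _; rewrite !mxE.
move=> c; rewrite sumE => /u_free cQ0 i.
have : \row_j c j *m Qm *m Pm = 0.
  rewrite (_ : _ *m Qm = 0) ?mul0mx //; apply/rowP => l; rewrite !mxE -[RHS](cQ0 l).
  by apply: eq_bigr => j _; rewrite !mxE.
by rewrite -mulmxA (mulmx1C PQ1) mulmx1 => /rowP/(_ i); rewrite !mxE.
Qed.

Lemma lin_indep_sub (T : finType) (b : T -> M) m (h : 'I_m -> T) :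
  injective h -> (forall c : T -> R, \sum_t c t *: b t = 0 -> forall t, c t = 0) ->
  lin_indep (fun i => b (h i)).
Proof.
move=> h_inj b_free c c0 i.
rewrite -[RHS](b_free (fun t => \sum_(j | h j == t) c j) _ (h i)); last first.
  rewrite -[RHS]c0 (partition_big h xpredT) //=; apply: eq_bigr => t _.
  by rewrite scaler_suml; apply: eq_bigr => j /eqP ->.
by rewrite (big_pred1 i) // => j; rewrite (inj_eq h_inj).
Qed.

Lemma card_bij (T : finType) n : #|T| = n -> exists h : 'I_n -> T, bijective h.
Proof.
move=> cT; exists (fun i => enum_val (cast_ord (esym cT) i)).
exists (fun t => cast_ord cT (enum_rank t)) => [i|t].
  by rewrite enum_valK cast_ordKV.
by rewrite cast_ordK enum_rankK.
Qed.

End Families.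

Section Span.
Variables (R : comNzRingType) (M : lmodType R) (T : finType) (b : T -> M).

Definition in_span (x : M) := exists c : T -> R, x = \sum_t c t *: b t.

Lemma in_span0 : in_span 0.
Proof. by exists (fun=> 0); rewrite big1 // => t _; rewrite scale0r. Qed.

Lemma in_spanD x x' : in_span x -> in_span x' -> in_span (x + x').
Proof.
move=> [c ->] [c' ->]; exists (fun t => c t + c' t).
by rewrite -big_split; apply: eq_bigr => t _; rewrite scalerDl.
Qed.

Lemma in_spanZ r x : in_span x -> in_span (r *: x).
Proof.
move=> [c ->]; exists (fun t => r * c t).
by rewrite scaler_sumr; apply: eq_bigr => t _; rewrite scalerA.
Qed.

Lemma in_spanB x x' : in_span x -> in_span x' -> in_span (x - x').
Proof. by move=> xS x'S; rewrite -scaleN1r; apply/in_spanD/in_spanZ. Qed.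

Lemma in_span_sum I (r : seq I) (F : I -> M) :
  (forall i, in_span (F i)) -> in_span (\sum_(i <- r) F i).
Proof. by move=> FS; apply: big_ind => //; [exact: in_span0 | exact: in_spanD]. Qed.

Lemma in_span_gen t : in_span (b t).
Proof.
exists (fun t' => (t' == t)%:R); rewrite (bigD1 t) //= eqxx scale1r big1 ?addr0 //.
by move=> t' /negPf ->; rewrite scale0r.
Qed.

Lemma in_span_image (f : M -> M) :
  semilin *:%R f -> (forall t, in_span (f (b t))) -> forall x, in_span x -> in_span (f x).
Proof.
move=> fL fb x [c ->]; rewrite (semilin_sum _ _ _ fL); apply: in_span_sum => t.
by rewrite fL.2; apply: in_spanZ.
Qed.
End Span.

(** * The ring S with its power basis *)
Section PowerBasis.
Variables (R : comUnitRingType) (k : nat) (q_ : nat -> R).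

Definition cyclo_poly : {poly R} := 'X^k - \poly_(i < k) q_ i.

Hypothesis k_gt0 : (0 < k)%N.
Local Notation S := {poly %/ cyclo_poly}.
Let y : S := in_qpoly cyclo_poly 'X.

Lemma size_cyclo_tail : (size (- \poly_(i < k) q_ i) < size ('X^k : {poly R}))%N.
Proof. by rewrite size_polyN size_polyXn ltnS size_poly. Qed.

(** The quotient ring is formed modulo mk_monic of its parameter, which is the
    parameter itself only for a monic polynomial of positive degree. *)
Lemma mk_monic_cyclo : mk_monic cyclo_poly = cyclo_poly.
Proof.
rewrite /mk_monic size_polyDl ?size_cyclo_tail // size_polyXn ltnS k_gt0 /=.
by rewrite monicE lead_coefDl ?size_cyclo_tail // lead_coefXn eqxx.
Qed.

Lemma size_cyclo_monic : size (mk_monic cyclo_poly) = k.+1.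
Proof. by rewrite mk_monic_cyclo size_polyDl ?size_cyclo_tail // size_polyXn. Qed.

Definition cyclo_coef (i : nat) (s : S) : R := (s : {poly R})`_i.

Fact cyclo_coef_scalar i : scalar (cyclo_coef i).
Proof. by move=> a s t; rewrite /cyclo_coef coefD coefZ. Qed.
HB.instance Definition _ i := GRing.isLinear.Build R S R *%R (cyclo_coef i)
  (cyclo_coef_scalar i).

Lemma cyclo_coefX (i j : nat) : (j < k)%N -> cyclo_coef i (y ^+ j) = (i == j)%:R.
Proof.
move=> jk; rewrite /cyclo_coef /y -rmorphXn in_qpoly_small ?coefXn //.
by rewrite size_cyclo_monic size_polyXn ltnS.
Qed.

Lemma cyclo_expand (s : S) : s = \sum_(i < k) cyclo_coef i s *: y ^+ i.
Proof.
apply/val_inj/polyP => j; rewrite -/(cyclo_coef j s) -[RHS]/(cyclo_coef j _).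
rewrite linear_sum; case: (ltnP j k) => [jk|kj]; last first.
  rewrite big1 => [|i _].
    apply/nth_default/(leq_trans _ kj); rewrite -ltnS -size_cyclo_monic.
    exact: size_mk_monic.
  by rewrite linearZ /= cyclo_coefX // gtn_eqF ?mulr0 // (leq_trans _ kj).
rewrite (bigD1 (Ordinal jk)) //= linearZ /= cyclo_coefX // eqxx mulr1 big1 ?addr0 // => i.
rewrite -val_eqE /= => ij; rewrite linearZ /= cyclo_coefX // eq_sym.
by rewrite (negPf ij) mulr0.
Qed.

Lemma cyclo_root : y ^+ k = \sum_(i < k) q_ i *: y ^+ i.
Proof.
apply/eqP; rewrite -subr_eq0; apply/eqP.
have -> : \sum_(i < k) q_ i *: y ^+ i = in_qpoly cyclo_poly (\poly_(i < k) q_ i).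
  by rewrite poly_def raddf_sum; apply: eq_bigr => i _; rewrite /= in_qpolyZ rmorphXn.
rewrite -[y ^+ k]rmorphXn -rmorphB -/cyclo_poly; apply/val_inj => /=.
rewrite -[X in Pdiv.CommonRing.rmodp X]mk_monic_cyclo.
by rewrite Pdiv.RingMonic.rmodpp ?monic_mk_monic.
Qed.
End PowerBasis.

(** * Reindexing double sums *)
Section Sums.
Variable V : nmodType.

Lemma big_nat_ord (F : nat -> V) a b N : (b <= N)%N ->
  \sum_(a <= i < b) F i = \sum_(i < N | (a <= i < b)%N) F i.
Proof.
move=> bN; rewrite (big_nat_widenl _ 0%N) // (big_nat_widen _ _ N) // big_mkord.
by apply: eq_bigl => i.
Qed.

Lemma sum_triangle (F : nat -> nat -> V) n :
  \sum_(1 <= m < n.+1) \sum_(1 <= i < m) F m i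
  = \sum_(1 <= i < n) \sum_(i.+1 <= m < n.+1) F m i.
Proof.
rewrite (big_nat_ord _ _ (leqnn _)) (@big_nat_ord _ _ _ n.+1) ?leqnSn //.
rewrite (eq_bigr (fun m : 'I_n.+1 => \sum_(i < n.+1 | (1 <= i < m)%N) F m i)); last first.
  by move=> m _; rewrite (@big_nat_ord _ _ _ n.+1) // ltnW.
rewrite (exchange_big_dep (fun i : 'I_n.+1 => (1 <= i < n)%N)) /=; last by lia.
apply: eq_bigr => i Hi; rewrite (big_nat_ord _ _ (leqnn _)).
by apply: eq_bigl => m; lia.
Qed.

Lemma sum_addend (F : nat -> V) N l n : (n - l < N)%N -> (l <= n)%N ->
  \sum_(m < N | (m + l == n)%N) F m = F (n - l)%N.
Proof.
move=> nN ln; rewrite (big_pred1 (Ordinal nN)) // => m.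
by rewrite /= -val_eqE /=; lia.
Qed.

(** Both sides run over the triples (i, m, l) with m + l = 2i and C i m: the two
    assumptions say that m <= 2i and that m, l and i stay below N. *)
Lemma sum_by_difference (F : nat -> nat -> V) N (C : nat -> nat -> bool) :
  (forall i m, C i m -> (m <= i.*2 < m + N)%N) ->
  (forall i m, C i m -> (i < N)%N && (m < N)%N) ->
  \sum_(i < N) \sum_(m < N | C i m) F m (i.*2 - m)%N
  = \sum_(l < N) \sum_(i < N | (l <= i.*2)%N && C i (i.*2 - l)%N) F (i.*2 - l)%N l.
Proof.
move=> C1 C2.
transitivity (\sum_(i < N) \sum_(m < N | C i m) \sum_(l < N | (l + m == i.*2)%N) F m l).
  apply: eq_bigr => i _; apply: eq_bigr => m Cim.
  by have := C1 _ _ Cim => ?; rewrite (sum_addend (F m)) //; lia.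
under eq_bigr => i _ do rewrite (exchange_big_dep xpredT) //=.
rewrite exchange_big; apply: eq_bigr => l _; rewrite [RHS]big_mkcond.
apply: eq_bigr => i _; case: ifP => [/andP[li Cil]|Cn].
  have ltN : (i.*2 - l < N)%N by have /andP[] := C2 _ _ Cil.
  rewrite (big_pred1 (Ordinal ltN)) // => m; rewrite /= -val_eqE /=.
  apply/andP/eqP => [[_ /eqP]|->]; first lia.
  by split; [exact: Cil|lia].
rewrite big1 // => m /andP[Cim /eqP mE].
have ml : (nat_of_ord m = i.*2 - l)%N by lia.
by move: Cn; rewrite -ml Cim andbT; lia.
Qed.

End Sums.

(** * Inverting a root of the polynomial *)
Section InverseOfRoot.
Variables (R : comUnitRingType) (k : nat) (q_ : nat -> R).
Hypotheses (k_gt0 : (0 < k)%N) (q0_unit : q_ 0%N \is a GRing.unit).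

(** The constant coefficient being a unit, Y divides a unit on both sides.  The
    ring T may be noncommutative: the lemma inverts both y and the matrix by
    which Y will act. *)
Lemma cyclo_inv (T : pzRingType) (phi : {rmorphism R -> T}) (Y : T) :
  (forall r t, phi r * t = t * phi r) ->
  Y ^+ k = \sum_(i < k) phi (q_ i) * Y ^+ i ->
  exists Z, Y * Z = 1 /\ Z * Y = 1.
Proof.
case: k k_gt0 => // n _ phiC Yn.
pose P := Y ^+ n - \sum_(i < n) phi (q_ i.+1) * Y ^+ i.
have YP : Y * P = phi (q_ 0%N).
  rewrite /P mulrBr -exprS Yn big_ord_recl expr0 mulr1 mulr_sumr.
  rewrite [X in _ - X](eq_bigr (fun i : 'I_n => phi (q_ i.+1) * Y ^+ i.+1)).
    by rewrite addrK.
  by move=> i _; rewrite mulrA -phiC -mulrA -exprS.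
have PY : P * Y = phi (q_ 0%N).
  rewrite -YP /P mulrBl mulrBr -exprSr -exprS mulr_suml mulr_sumr; congr (_ - _).
  by apply: eq_bigr => i _; rewrite -mulrA -exprSr mulrA -phiC -mulrA -exprS.
exists (phi (q_ 0%N)^-1 * P); split.
  by rewrite mulrA -phiC -mulrA YP -rmorphM mulVr // rmorph1.
by rewrite -mulrA PY -rmorphM mulVr // rmorph1.
Qed.

End InverseOfRoot.

(** * Maps out of S *)

(** S is described only by the inverse of y, the relation satisfied by y, and
    the coordinates co in the basis of powers of y. *)
Section CyclotomicBMW.
Variables (R : comUnitRingType) (k : nat) (q lambda : R) (q_ A : nat -> R).
Hypotheses (k_gt0 : (0 < k)%N) (q0_unit : q_ 0%N \is a GRing.unit)
  (lambda_unit : lambda \is a GRing.unit).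
Hypothesis hA0 : lambda - lambda^-1 = delta q * (1 - A 0%N).
Variables (S : comAlgType R) (y yi : S) (co : nat -> {scalar S}).
Hypothesis y_inv : y * yi = 1.
Hypothesis y_root : y ^+ k = \sum_(i < k) q_ i *: y ^+ i.
Hypothesis coX : forall i j, (j < k)%N -> co i (y ^+ j) = (i == j)%:R.
Hypothesis co_expand : forall s, s = \sum_(i < k) co i s *: y ^+ i.

Local Notation qt := (qx k q_).
Local Notation B := (BMW2 k q lambda q_ A).
Local Notation Y := (bY k q lambda q_ A).
Local Notation Yi := (bYi k q lambda q_ A).
Local Notation X := (bX k q lambda q_ A).
Local Notation Xi := (bXi k q lambda q_ A).
Local Notation e := (be k q lambda q_ A).

Lemma semilin_ext (W : zmodType) (s : R -> W -> W) F G :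
  semilin s F -> semilin s G -> (forall i, (i < k)%N -> F (y ^+ i) = G (y ^+ i)) ->
  forall p : S, F p = G p.
Proof.
move=> FL GL FG p; rewrite [p]co_expand (semilin_sum _ _ _ FL) (semilin_sum _ _ _ GL).
by apply: eq_bigr => i _; rewrite FL.2 GL.2 FG.
Qed.

Lemma S_powers_free (c : 'I_k -> R) :
  \sum_(i < k) c i *: y ^+ i = 0 -> forall i, c i = 0.
Proof.
move=> c0 i; have /(congr1 (co i)) := c0; rewrite linear0 linear_sum => <-.
rewrite (bigD1 i) //= linearZ /= coX // eqxx mulr1 big1 ?addr0 // => j ji.
by rewrite linearZ /= coX // val_eqE eq_sym (negPf ji) mulr0.
Qed.

Section Lext.
Variables (W : lmodType R) (w : nat -> W).
Definition lext (p : S) : W := \sum_(i < k) co i p *: w i.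

Fact lext_is_linear : linear lext.
Proof.
move=> r p p'; rewrite /lext scaler_sumr -big_split; apply: eq_bigr => i _ /=.
by rewrite linearP /= scalerDl scalerA.
Qed.
HB.instance Definition _ := GRing.isLinear.Build R S W *:%R lext lext_is_linear.

Lemma lext_semilin : semilin *:%R lext.
Proof. by split=> *; rewrite ?linearD ?linearZ. Qed.

Lemma lextX j : (j < k)%N -> lext (y ^+ j) = w j.
Proof.
move=> jk; rewrite /lext (bigD1 (Ordinal jk)) //= coX // eqxx scale1r.
rewrite big1 ?addr0 // => i; rewrite -val_eqE /= => ij.
by rewrite coX // (negPf ij) scale0r.
Qed.

(** Multiplication by y corresponds to every map f which shifts the family w and
    closes it up by the relation satisfied by y^k. *)
Lemma lext_mulX (f : W -> W) :
  (forall v v', f (v + v') = f v + f v') -> (forall r v, f (r *: v) = r *: f v) ->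
  (forall i, (i.+1 < k)%N -> f (w i) = w i.+1) ->
  f (w k.-1) = \sum_(i < k) q_ i *: w i ->
  forall p, lext (y * p) = f (lext p).
Proof.
move=> fD fZ fS fk; apply: (@semilin_ext _ *:%R).
- by split=> *; rewrite ?mulrDr -?scalerAr ?linearD ?linearZ.
- by split=> *; rewrite ?linearD ?linearZ ?fD ?fZ.
move=> i ik; rewrite -exprS [lext (y ^+ i)]lextX //.
have [ik1|ki] := ltnP i.+1 k; first by rewrite lextX ?fS.
have -> : i = k.-1 by apply/eqP; rewrite eqn_leq -ltnS prednK // ik -ltnS prednK.
rewrite fk prednK // y_root linear_sum; apply: eq_bigr => j _.
by rewrite linearZ /= lextX.
Qed.

End Lext.

(** * The recurrence and admissibility *)
Local Notation d := (delta q).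

Let lambda_inv : lambda - d + d * A 0%N = lambda^-1.
Proof. by rewrite -[RHS](subrK lambda) -[X in _ = X + _]opprB hA0; ring. Qed.

(** For m < k these are the x_m with X Y^m e = x_m(Y) e, as shown in X_evalY_e;
    the step comes from YXY = X - d + d e on the left ideal of e. *)
Fixpoint Xcoord (m : nat) : S :=
  if m is n.+1 then yi * (Xcoord n - d *: y ^+ n + (d * A n)%:A)
  else lambda%:A.

Lemma yXV n m : (m <= n)%N -> y ^+ n * yi ^+ m = y ^+ (n - m).
Proof.
by move=> mn; rewrite -{1}(subnK mn) exprD -mulrA -exprMn y_inv expr1n mulr1.
Qed.

Lemma yVX n m : (n <= m)%N -> y ^+ n * yi ^+ m = yi ^+ (m - n).
Proof.
by move=> nm; rewrite -{1}(subnKC nm) exprD mulrA -exprMn y_inv expr1n mul1r.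
Qed.

(** The start of the recurrence contributes lambda - d + d A_0 = lambda^-1 times
    y^-m, so no term of index m is left in the sum. *)
Lemma Xcoord_closed m : (0 < m)%N -> Xcoord m = lambda^-1 *: yi ^+ m
  + d *: \sum_(1 <= i < m) (A (m - i)%N *: yi ^+ i - y ^+ m * yi ^+ i.*2).
Proof.
case: m => // m _; elim: m => [|m IHm].
  rewrite /= big_geq // expr0 -scalerBl -scalerDl lambda_inv.
  by rewrite scaler0 addr0 -scalerAr mulr1 expr1.
rewrite [LHS]/= -/(Xcoord m.+1) IHm.
rewrite [in RHS]big_nat_recl // subn1 [_.+1.-1]/=.
have -> : \sum_(1 <= i < m.+1)
    (A (m.+2 - i.+1)%N *: yi ^+ i.+1 - y ^+ m.+2 * yi ^+ i.+1.*2)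
  = yi * \sum_(1 <= i < m.+1) (A (m.+1 - i)%N *: yi ^+ i - y ^+ m.+1 * yi ^+ i.*2).
  rewrite mulr_sumr; apply: eq_bigr => i _; rewrite mulrBr -scalerAr -exprS subSS.
  by congr (_ - _); rewrite doubleS [y ^+ m.+2]exprS !(exprS yi) mulrACA y_inv mul1r mulrCA.
set Sg := \sum_(_ <= _ < _) _.
have -> : y ^+ m.+2 * yi ^+ 1.*2 = yi * y ^+ m.+1.
  by rewrite exprS expr2 mulrACA y_inv mul1r mulrC.
have scaleE a (x : S) : a *: x = in_alg S a * x by rewrite mulr_algl.
rewrite [yi ^+ m.+2]exprS expr1 !scaleE rmorphM.
move: (Sg) (y ^+ m.+1) (yi ^+ m.+1) => s u v; ring.
Qed.

Lemma qxE m : (m < k)%N -> qt m = q_ m.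
Proof. by rewrite /qx => /ltn_eqF ->. Qed.

Lemma qxk : qt k = -1.
Proof. by rewrite /qx eqxx. Qed.

Lemma big_qx (V : lmodType R) (F : nat -> V) :
  \sum_(m < k.+1) qt m *: F m = \sum_(m < k) q_ m *: F m - F k.
Proof.
rewrite big_ord_recr /= qxk scaleN1r; congr (_ - _).
by apply: eq_bigr => m _; rewrite qxE.
Qed.

Lemma qx_root : \sum_(m < k.+1) qt m *: y ^+ m = 0.
Proof. by rewrite (big_qx (GRing.exp y)) y_root subrr. Qed.

Lemma yiXk : yi ^+ k = (q_ 0%N)^-1 *: (1 - \sum_(1 <= l < k) q_ (k - l)%N *: yi ^+ l).
Proof.
have : \sum_(m < k.+1) qt m *: (y ^+ m * yi ^+ k) = 0.
  transitivity ((\sum_(m < k.+1) qt m *: y ^+ m) * yi ^+ k).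
    by rewrite mulr_suml; apply: eq_bigr => m _; rewrite scalerAl.
  by rewrite qx_root mul0r.
rewrite (big_qx (fun m => y ^+ m * yi ^+ k)) yXV // subnn expr0.
rewrite (eq_bigr (fun m : 'I_k => q_ m *: yi ^+ (k - m))); last first.
  by move=> m _; rewrite yVX // ltnW.
rewrite -(big_mkord xpredT (fun m => q_ m *: yi ^+ (k - m))) big_ltn // subn0.
rewrite (_ : \sum_(1 <= m < k) q_ m *: yi ^+ (k - m)
  = \sum_(1 <= l < k) q_ (k - l)%N *: yi ^+ l); last first.
  rewrite big_nat_rev; apply: eq_big_nat => i /andP[i1 ik].
  by rewrite add1n subSS; congr (_ *: _ ^+ _); lia.
move=> /eqP; rewrite -addrA addr_eq0 opprB => /eqP <-.
by rewrite scalerA mulVr // scale1r.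
Qed.

(* The exponents 2i - m with m <= k are all nonnegative exactly when i >= z. *)
Let z := uphalf k.

Definition upper_sum l : R := \sum_(maxn l.+1 z <= i < ((l + k)./2).+1) qt (2 * i - l).
Definition lower_sum l : R := \sum_(uphalf l <= i < (minn l z.-1).+1) qt (2 * i - l).

(** Here y^m y^-2i is y^-l for l = 2i - m >= 0, and the terms are collected by l.
    The value l = 0 needs m = k = 2i, that is k even and i = z, with the
    coefficient q_k = -1. *)
Lemma upper_part :
  \sum_(z <= i < k) \sum_(i.+1 <= m < k.+1) qt m *: (y ^+ m * yi ^+ i.*2)
  = (- (~~ odd k)%:R)%:A + \sum_(1 <= l < k) upper_sum l *: yi ^+ l.
Proof.
pose C i m := [&& z <= i, i < k & i < m <= k]%N.
transitivity (\sum_(i < k.+1) \sum_(m < k.+1 | C i m) qt m *: yi ^+ (i.*2 - m)).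
  rewrite (@big_nat_ord _ _ _ _ k.+1) ?leqnSn // big_mkcond; apply: eq_bigr => i _.
  case: ifP => iz; last by rewrite big_pred0 // => m; rewrite /C; lia.
  rewrite (big_nat_ord _ _ (leqnn _)); apply: eq_big => m; first by rewrite /C; lia.
  by move=> im; rewrite yVX //; lia.
rewrite (@sum_by_difference _ (fun m l => qt m *: yi ^+ l) k.+1 C); first last.
- by rewrite /C => i m; lia.
- by rewrite /C => i m; lia.
rewrite -(big_mkord xpredT (fun l => \sum_(i < k.+1 | (l <= i.*2)%N && C i (i.*2 - l)%N)
  qt (i.*2 - l)%N *: yi ^+ l)) big_ltn //.
rewrite big_nat_recr //= [X in _ + (_ + X)]big_pred0 ?addr0; last first.
  by move=> i; rewrite /C; lia.
congr (_ + _).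
  case: (boolP (odd k)) => ok.
    by rewrite big_pred0 => [|i]; rewrite /C ?oppr0 ?scale0r //; lia.
  have zk : (z < k.+1)%N by rewrite /z; lia.
  rewrite (big_pred1 (Ordinal zk)) => [|i]; last by rewrite /C /= -val_eqE /=; lia.
  by rewrite /= subn0 (_ : z.*2 = k) ?qxk ?expr0 //; rewrite /z; lia.
apply: eq_big_nat => l /andP[l1 lk].
rewrite -scaler_suml; congr (_ *: _); rewrite /upper_sum.
rewrite (@big_nat_ord _ _ _ _ k.+1); last by lia.
apply: eq_big => [i|i _]; last by rewrite mul2n.
by rewrite /C geq_max; lia.
Qed.

(** For i < z some of the exponents 2i - m are negative; as f(y) = 0, the sum over
    m > i is minus the sum over m <= i, where they are nonnegative again. *)
Lemma lower_part :
  \sum_(1 <= i < z) \sum_(i.+1 <= m < k.+1) qt m *: (y ^+ m * yi ^+ i.*2)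
  = - \sum_(1 <= l < k) lower_sum l *: yi ^+ l.
Proof.
pose C i m := [&& 1 <= i, i < z & m <= i]%N.
transitivity (- \sum_(i < k.+1) \sum_(m < k.+1 | C i m) qt m *: yi ^+ (i.*2 - m)).
  have zk : (z <= k.+1)%N by rewrite /z; lia.
  rewrite (big_nat_ord _ _ zk) big_mkcond -sumrN; apply: eq_bigr => i _.
  case: ifP => iz; last by rewrite big_pred0 ?oppr0 // => m; rewrite /C; lia.
  apply/eqP; rewrite -addr_eq0; apply/eqP.
  transitivity ((\sum_(m < k.+1) qt m *: y ^+ m) * yi ^+ i.*2); last first.
    by rewrite qx_root mul0r.
  rewrite mulr_suml [RHS](bigID (fun m : 'I_k.+1 => (i < m)%N)) /=; congr (_ + _).
    rewrite (big_nat_ord _ _ (leqnn _)); apply: eq_big => m; last by rewrite scalerAl.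
    by rewrite ltn_ord andbT.
  apply: eq_big => m; first by rewrite /C; lia.
  by rewrite /C => Cm; rewrite -scalerAl yVX //; lia.
rewrite (@sum_by_difference _ (fun m l => qt m *: yi ^+ l) k.+1 C); first last.
- by rewrite /C /z => i m; lia.
- by rewrite /C /z => i m; lia.
rewrite -(big_mkord xpredT (fun l => \sum_(i < k.+1 | (l <= i.*2)%N && C i (i.*2 - l)%N)
  qt (i.*2 - l)%N *: yi ^+ l)) big_ltn // [X in X + _]big_pred0 ?add0r; last first.
  by move=> i; rewrite /C; lia.
rewrite big_nat_recr //= [X in _ + X]big_pred0 ?addr0; last first.
  by move=> i; rewrite /C /z; lia.
congr (- _); apply: eq_big_nat => l /andP[l1 lk].
rewrite -scaler_suml; congr (_ *: _); rewrite /lower_sum.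
rewrite (@big_nat_ord _ _ _ _ k.+1); last by rewrite /z; lia.
apply: eq_big => [i|i _]; last by rewrite mul2n.
by rewrite /C /z; lia.
Qed.

(** In the closed form of x_m, the term lambda^-1 y^-m gives the q_l, and for
    m = k, through yiXk, also the q_0^-1 q_(k-l); the terms in A_j give the first
    sum of h_l, and the others give its last two sums by upper_part and
    lower_part. *)
Lemma Xcoord_defect :
  \sum_(i < k) q_ i *: Xcoord i - Xcoord k
  = (beta k q lambda q_)%:A + \sum_(1 <= l < k) hl k q lambda q_ A l *: yi ^+ l.
Proof.
rewrite -(big_qx Xcoord) -(big_mkord xpredT (fun m => qt m *: Xcoord m)) big_ltn // qxE //=.
rewrite (eq_big_nat _ _ (F2 := fun m => lambda^-1 *: (qt m *: yi ^+ m)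
   + d *: (\sum_(1 <= i < m) (qt m * A (m - i)%N) *: yi ^+ i
        - \sum_(1 <= i < m) qt m *: (y ^+ m * yi ^+ i.*2)))); last first.
  move=> m /andP[m0 _]; rewrite Xcoord_closed // scalerDr !scalerA mulrC.
  congr (_ + _); rewrite mulrC -scalerA; congr (_ *: _).
  rewrite sumrB scalerBr !scaler_sumr; congr (_ - _).
  by apply: eq_bigr => i _; rewrite scalerA.
rewrite big_split /= -!scaler_sumr sumrB.
rewrite (sum_triangle (fun m i => (qt m * A (m - i)%N) *: yi ^+ i)).
rewrite (sum_triangle (fun m i => qt m *: (y ^+ m * yi ^+ i.*2))).
rewrite (@big_cat_nat _ _ _ z _ _ xpredT
  (fun i => \sum_(i.+1 <= m < k.+1) qt m *: (y ^+ m * yi ^+ i.*2))) /=;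
  try by rewrite /z; lia.
rewrite lower_part upper_part.
rewrite big_nat_recr //= qxk scaleN1r yiXk.
have -> : \sum_(1 <= m < k) qt m *: yi ^+ m = \sum_(1 <= l < k) q_ l *: yi ^+ l.
  by apply: eq_big_nat => l /andP[_ lk]; rewrite qxE.
have -> : \sum_(1 <= l < k) \sum_(l.+1 <= m < k.+1) (qt m * A (m - l)%N) *: yi ^+ l
  = \sum_(1 <= l < k) (\sum_(1 <= r < (k - l).+1) qt (r + l) * A r) *: yi ^+ l.
  apply: eq_big_nat => l /andP[_ lk].
  rewrite scaler_suml -add1n big_addn subSn ?(ltnW lk) //.
  by apply: eq_bigr => r _; rewrite addnK.
rewrite [in RHS](eq_big_nat _ _ (F2 := fun l => lambda^-1 *: (q_ l *: yi ^+ l) +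
   (lambda^-1 * (q_ 0%N)^-1) *: (q_ (k - l)%N *: yi ^+ l)
   + d *: ((\sum_(1 <= r < (k - l).+1) qt (r + l) * A r) *: yi ^+ l)
   - d *: (upper_sum l *: yi ^+ l)
   + d *: (lower_sum l *: yi ^+ l))); last first.
  move=> l _; rewrite /hl -/(upper_sum l) -/(lower_sum l) !scalerA.
  rewrite -!scalerDl -scalerBl -scalerDl.
  by congr (_ *: _); ring.
rewrite !(big_split, sumrB) /= sumrN -!scaler_sumr.
rewrite /beta.
set S1 := \sum_(_ <= _ < _) _; set S2 := \sum_(_ <= _ < _) _.
set S3 := \sum_(_ <= _ < _) _; set S4 := \sum_(_ <= _ < _) lower_sum _ *: _.
set S5 := \sum_(_ <= _ < _) upper_sum _ *: _.
have scaleE a (x : S) : a *: x = in_alg S a * x by rewrite mulr_algl.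
move: S1 S2 S3 S4 S5 => S1 S2 S3 S4 S5.
move: (~~ odd k)%:R (q_ 0%N)^-1 lambda^-1 => ev q0i li.
by rewrite !scaleE !(rmorphD, rmorphN, rmorphM); ring.
Qed.

Local Notation x_ := Xcoord.

(** The actions of X and e on S when p in S stands for the element p(Y) e; the
    action of e is p |-> efun p times 1. *)
Definition Xop (p : S) : S := lext x_ p.
Definition efun (p : S) : R := lext (W := R^o) A p.
Local Notation xi := Xop.
Local Notation Af := efun.

Lemma XopD u v : xi (u + v) = xi u + xi v.
Proof. by rewrite /Xop linearD. Qed.
Lemma XopZ r u : xi (r *: u) = r *: xi u.
Proof. by rewrite /Xop linearZ. Qed.
Lemma Xop_semilin : semilin *:%R xi.
Proof. by split; [exact: XopD | exact: XopZ]. Qed.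
Lemma XopX i : (i < k)%N -> xi (y ^+ i) = x_ i.
Proof. exact: lextX. Qed.

Lemma efunD u v : Af (u + v) = Af u + Af v.
Proof. by rewrite /efun linearD. Qed.
Lemma efunZ r u : Af (r *: u) = r * Af u.
Proof. by rewrite /efun linearZ. Qed.
Lemma efunX i : (i < k)%N -> Af (y ^+ i) = A i.
Proof. exact: (lextX (W := R^o)). Qed.

(** The powers 1, y^-1, ..., y^-(k-1) are independent because y^(k-1) carries
    them to powers of y. *)
Lemma Xcoord_recurrence_admissible :
  \sum_(i < k) q_ i *: x_ i = x_ k <-> admissible k q lambda q_ A.
Proof.
have := Xcoord_defect.
set s := \sum_(1 <= l < k) _ => dE; split=> [E|[_ hl0 beta0]]; last first.
  apply/eqP; rewrite -subr_eq0 dE beta0 scale0r add0r; apply/eqP.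
  by apply: big1_seq => l; rewrite mem_index_iota => /= lk; rewrite hl0 ?scale0r //; lia.
move: dE; rewrite E subrr => /esym dE.
pose c i := if i == k.-1 then beta k q lambda q_ else hl k q lambda q_ A (k.-1 - i).
have c0 : forall i : 'I_k, c i = 0.
  apply: S_powers_free; rewrite -[RHS](mulr0 (y ^+ k.-1)) -[in RHS]dE.
  rewrite -(big_mkord xpredT (fun i => c i *: y ^+ i)).
  rewrite -[in X in \sum_(_ <= _ < X) _](prednK k_gt0) big_nat_recr //=.
  rewrite mulrDr addrC {1}/c eqxx -scalerAr mulr1; congr (_ + _).
  rewrite /s big_add1 mulr_sumr [LHS]big_nat_rev; apply: eq_big_nat => l /andP[_ lk].
  rewrite -scalerAr yXV // add0n /c; congr (_ *: y ^+ _).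
  by rewrite (_ : (_ == _) = false); [congr hl|]; lia.
split=> // [l /andP[l1 lk]|].
  have lk' : (k.-1 - l < k)%N by lia.
  have := c0 (Ordinal lk'); rewrite /c /= (_ : (_ == _) = false); last by lia.
  by rewrite (_ : (k.-1 - (k.-1 - l))%N = l) //; lia.
have kk : (k.-1 < k)%N by lia.
by have := c0 (Ordinal kk); rewrite /c /= eqxx.
Qed.

Lemma Xop1 : xi 1 = lambda%:A.
Proof. by rewrite -(expr0 y) XopX. Qed.

Lemma efun1 : Af 1 = A 0%N.
Proof. by rewrite -(expr0 y) efunX. Qed.

(** * The module S under the recurrence *)
Section Recurrence.
Hypothesis x_k : \sum_(i < k) q_ i *: x_ i = x_ k.

(** As an identity between operators on S this is YXY = X - d + d e; only its
    value at y^(k-1) uses the recurrence. *)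
Lemma Xop_mulX p : y * xi (y * p) = xi p - d *: p + (d * Af p)%:A.
Proof.
have E : forall p, xi (y * p) = yi * (xi p - d *: p + (d * Af p)%:A).
  apply: (@semilin_ext _ *:%R).
  - by split=> *; rewrite ?mulrDr -?scalerAr ?XopD ?XopZ.
  - split=> [u v|r u].
      by rewrite XopD efunD scalerDr (mulrDr d) [(_ * Af u + _)%:A]scalerDl; ring.
    rewrite XopZ efunZ scalerAr; congr (_ * _); rewrite scalerDr scalerBr !scalerA.
    by rewrite mulrCA [d * r]mulrC.
  move=> i ik; rewrite -exprS [xi (y ^+ i)]XopX // efunX //.
  have [ik1|ki] := ltnP i.+1 k; first by rewrite XopX.
  have {2 3 4}-> : i = k.-1 by lia.
  have -> : i.+1 = k by lia.
  rewrite y_root (semilin_sum _ _ _ Xop_semilin).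
  rewrite (eq_bigr (fun i : 'I_k => q_ i *: x_ i)) => [|j _]; last by rewrite XopZ XopX.
  by rewrite x_k -{1}[k]prednK.
by rewrite E mulrA y_inv mul1r.
Qed.

Lemma Xop_y : y * xi y = (lambda^-1)%:A.
Proof. by rewrite -{2}[y]mulr1 Xop_mulX Xop1 efun1 -scalerBl -scalerDl lambda_inv. Qed.

Local Notation g p := (Af (xi p) - lambda * Af p).
Local Notation W p := (xi (y * xi (y * p))).

Let W1 : W 1 = 1.
Proof. by rewrite mulr1 Xop_y XopZ Xop1 scalerA mulVr ?scale1r. Qed.

(* With Z = YXY = X - d + d e, both W(yp) = X Z (yp) and y W(p) = Z X (yp) follow
   from Xop_mulX, so their difference is d times the commutator of X and e. *)
Let W_mulX p : W (y * p) = y * W p - (d * g (y * p))%:A.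
Proof.
rewrite [y * W p]Xop_mulX [y * xi (y * (y * p))]Xop_mulX.
rewrite -scaleN1r -[(d * Af _)%:A]/(_ *: _) !XopD !XopZ Xop1.
have scaleE a (x : S) : a *: x = in_alg S a * x by rewrite mulr_algl.
by rewrite !scaleE !(rmorphD, rmorphN, rmorphM); ring.
Qed.

Let W_powers n : W (y ^+ n) = y ^+ n - \sum_(i < n) (d * g (y ^+ i.+1)) *: y ^+ (n.-1 - i).
Proof.
elim: n => [|n IHn]; first by rewrite expr0 W1 big_ord0 subr0.
rewrite [in LHS]exprS W_mulX IHn mulrBr -exprS -addrA -opprD; congr (_ - _).
rewrite big_ord_recr /= subnn expr0; congr (_ + _).
rewrite mulr_sumr; apply: eq_bigr => i _; rewrite -scalerAr -exprS; congr (_ *: _ ^+ _).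
by have := ltn_ord i; lia.
Qed.

Let W_semilin : semilin *:%R (fun p => W p).
Proof. by split=> *; rewrite ?(mulrDr, XopD) // -!scalerAr !XopZ -scalerAr XopZ. Qed.

Hypothesis delta_reg : GRing.lreg d.

(* The sum of the q_n W(y^n), with q_k = -1, vanishes since f(y) = 0.  Its
   coefficient at y^(k-1-i) is d g(y^(i+1)) plus multiples of g(y^(j+1)) with
   j < i. *)
Let g_powers i : (i < k)%N -> g (y ^+ i.+1) = 0.
Proof.
elim/ltn_ind: i => i IHi ik.
have W0 : \sum_(n < k.+1) qt n *: W (y ^+ n) = 0.
  transitivity (W (\sum_(n < k.+1) qt n *: y ^+ n)).
    by rewrite (semilin_sum _ _ _ W_semilin); apply: eq_bigr => n _; rewrite W_semilin.2.
  by rewrite qx_root // -[in LHS](scale0r 0) W_semilin.2 scale0r.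
have {W0} : \sum_(n < k.+1) qt n *: \sum_(i < n) (d * g (y ^+ i.+1)) *: y ^+ (n.-1 - i) = 0.
  transitivity (\sum_(n < k.+1) qt n *: y ^+ n - \sum_(n < k.+1) qt n *: W (y ^+ n)).
    rewrite -sumrB; apply: eq_bigr => n _.
    by rewrite W_powers [in RHS]scalerBr opprD opprK addNKr.
  by rewrite W0 qx_root // subr0.
move=> /(congr1 (co (k.-1 - i)%N)).
rewrite linear0 linear_sum big_ord_recr /= big1 ?add0r => [|n _]; last first.
  rewrite linearZ /= linear_sum big1 ?mulr0 // => j _; rewrite linearZ /= coX; last first.
    by have := ltn_ord j; have := ltn_ord n; lia.
  have [ij|ij] := eqVneq (k.-1 - i)%N (n.-1 - j)%N; last by rewrite mulr0.
  rewrite IHi ?mulr0 ?mul0r //; have := ltn_ord j; have := ltn_ord n; lia.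
rewrite qxk scaleN1r linearN linear_sum (bigD1 (Ordinal ik)) //= linearZ /= coX; last by lia.
rewrite eqxx mulr1 big1 ?addr0 => [/eqP|j]; last first.
  rewrite -val_eqE /= linearZ /= coX => [ji|]; last by lia.
  rewrite (_ : (_ == _) = false) ?mulr0 //; have := ltn_ord j; lia.
by rewrite oppr_eq0 => /eqP dg; apply: delta_reg; rewrite mulr0.
Qed.

Lemma efun_Xop p : Af (xi p) = lambda * Af p.
Proof.
have gy : forall p, g (y * p) = 0.
  apply: (@semilin_ext R *%R) => [||i ik]; last by rewrite -exprS g_powers.
    split=> [u v|r u]; first by rewrite mulrDr !(XopD, efunD); ring.
    by rewrite -scalerAr !(XopZ, efunZ); ring.
  by split=> *; rewrite ?mulr0 ?addr0.
by apply/eqP; rewrite -subr_eq0 -[p]mul1r -y_inv -mulrA gy.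
Qed.

Lemma Xop_y_Xop_y p : xi (y * xi (y * p)) = p.
Proof.
move: p; apply: (@semilin_ext S *:%R) => // i ik.
rewrite W_powers big1 ?subr0 // => j _.
by rewrite g_powers ?mulr0 ?scale0r // (ltn_trans _ ik).
Qed.

End Recurrence.

(** * Left multiplication in the algebra *)
Lemma BMW2_scalerAl (a : R) (x x' : B) : a *: (x * x') = (a *: x) * x'.
Proof. exact: pscalerAl. Qed.

Lemma BMW2_scalerAr (a : R) (x x' : B) : a *: (x * x') = x * (a *: x').
Proof. exact: pscalerAr. Qed.

Lemma mull_semilin (x : B) : semilin *:%R (fun x' : B => x * x').
Proof. by split=> [u v|r u]; [exact: mulrDr | rewrite BMW2_scalerAr]. Qed.

(** The elements are sums of multiples of words in the generators, and words are
    built from 1 by multiplying on the left. *)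
Lemma BMW2_ind (P : B -> Prop) :
  P 1 -> (forall x x', P x -> P x' -> P (x + x')) -> (forall a x, P x -> P (a *: x)) ->
  (forall g x, P x -> P (pgen _ g * x)) -> forall x, P x.
Proof.
move=> P1 PD PZ Pg; suff main t (u : B) : P u -> P ((pclass _ t : B) * u).
  by apply: pclassW => t; rewrite -[pclass _ t](mulr1 (_ : B)); apply: main.
elim: t u => [g|a|t IHt s IHs|t IHt s IHs] u Pu.
- exact: Pg.
- exact: PZ.
- rewrite pclassD -/((pclass _ t : B) + pclass _ s) mulrDl.
  by apply: PD; [apply: IHt | apply: IHs].
- rewrite pclassM -/((pclass _ t : B) * pclass _ s) -mulrA.
  by apply: IHt; apply: IHs.
Qed.

Let Y_Yi : Y * Yi = 1. Proof. by case: (BMW2_rel k q lambda q_ A) => [[]]. Qed.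
Let Yi_Y : Yi * Y = 1. Proof. by case: (BMW2_rel k q lambda q_ A) => [[]]. Qed.
Let X_Xi : X * Xi = 1. Proof. by case: (BMW2_rel k q lambda q_ A) => [[]]. Qed.
Let Xi_X : Xi * X = 1. Proof. by case: (BMW2_rel k q lambda q_ A) => [[]]. Qed.
Let Y_k : Y ^+ k = \sum_(i < k) q_ i *: Y ^+ i.
Proof. by case: (BMW2_rel k q lambda q_ A). Qed.
Let skein : X - Xi = d *: (1 - e). Proof. by case: (BMW2_rel k q lambda q_ A). Qed.
Let braid : X * Y * X * Y = Y * X * Y * X.
Proof. by case: (BMW2_rel k q lambda q_ A). Qed.
Let X_e : X * e = lambda *: e.
Proof. by case: (BMW2_rel k q lambda q_ A) => _ _ _ _ []. Qed.
Let e_X : e * X = lambda *: e.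
Proof. by case: (BMW2_rel k q lambda q_ A) => _ _ _ _ []. Qed.
Let YXYe : Y * X * Y * e = lambda^-1 *: e.
Proof. by case: (BMW2_rel k q lambda q_ A) => _ _ _ _ []. Qed.
Let eYXY : e * Y * X * Y = lambda^-1 *: e.
Proof. by case: (BMW2_rel k q lambda q_ A) => _ _ _ _ []. Qed.
Let eYe m : (m < k)%N -> e * Y ^+ m * e = A m *: e.
Proof. by case: (BMW2_rel k q lambda q_ A) => _ _ _ _ [_ _ _ _ eYe]; apply: eYe. Qed.

Lemma XiE : Xi = X - d *: (1 : B) + d *: e.
Proof. by rewrite -addrA [_ + d *: e]addrC -scalerBr -opprB scalerN -skein subKr. Qed.

Lemma X_squared : X * X = 1 + d *: X - (d * lambda) *: e.
Proof.
rewrite -X_Xi XiE mulrDr mulrBr -!BMW2_scalerAr mulr1 X_e scalerA.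
by rewrite -addrA addrCA addrK addrC subrK.
Qed.

Local Notation C := (X * Y * X * Y).

Lemma central_Y : Y * C = C * Y. Proof. by rewrite {2}braid !mulrA. Qed.
Lemma central_e_left : C * e = e.
Proof.
rewrite -!mulrA [X in _ * X]mulrA [X in _ * X]mulrA YXYe -BMW2_scalerAr X_e.
by rewrite scalerA mulVr // scale1r.
Qed.
Lemma central_e_right : e * C = e.
Proof.
by rewrite !mulrA e_X -!BMW2_scalerAl eYXY scalerA mulrV // scale1r.
Qed.

Lemma YXY_left : Y * X * Y = Xi * C.
Proof. by rewrite !mulrA Xi_X mul1r. Qed.
Lemma YXY_right : Y * X * Y = C * Xi.
Proof. by rewrite braid -[RHS]mulrA X_Xi mulr1. Qed.

Definition evalY (p : S) : B := lext (fun i => Y ^+ i) p.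
Local Notation ev := evalY.

Lemma evalY_semilin : semilin *:%R ev.
Proof. exact: lext_semilin. Qed.

Lemma evalYD p p' : ev (p + p') = ev p + ev p'.
Proof. exact: evalY_semilin.1. Qed.
Lemma evalYZ r p : ev (r *: p) = r *: ev p.
Proof. exact: evalY_semilin.2. Qed.
Lemma evalYB p p' : ev (p - p') = ev p - ev p'.
Proof. by rewrite evalYD -scaleN1r evalYZ scaleN1r. Qed.

Lemma evalYX i : (i < k)%N -> ev (y ^+ i) = Y ^+ i.
Proof. exact: lextX. Qed.

Lemma evalY1 : ev 1 = 1.
Proof. by rewrite -(expr0 y) evalYX. Qed.

Lemma evalY_mulX p : ev (y * p) = Y * ev p.
Proof.
apply: (lext_mulX (f := *%R Y)) => [u v|r u|i _|].
- exact: mulrDr.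
- by rewrite BMW2_scalerAr.
- by rewrite exprS.
- by rewrite -exprS prednK // Y_k.
Qed.

Lemma evalYM p p' : ev (p * p') = ev p * ev p'.
Proof.
move: p; apply: (semilin_ext (s := *:%R)).
- by split=> *; rewrite ?mulrDl -?scalerAl ?evalY_semilin.1 ?evalY_semilin.2.
- by split=> *; rewrite ?evalY_semilin.1 ?evalY_semilin.2 ?mulrDl ?BMW2_scalerAl.
move=> i ik; rewrite evalYX //; elim: i {ik} => [|i IHi]; first by rewrite !mul1r.
by rewrite !exprS -!mulrA evalY_mulX IHi.
Qed.

Lemma evalYy : ev y = Y.
Proof. by rewrite -[y]mulr1 evalY_mulX evalY1 mulr1. Qed.

Lemma evalYyi : ev yi = Yi.
Proof. by rewrite -[LHS]mul1r -Yi_Y -mulrA -evalY_mulX y_inv evalY1 mulr1. Qed.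

Lemma evalY_comm (x : B) : Y * x = x * Y -> forall p, ev p * x = x * ev p.
Proof.
move=> Yx; apply: (semilin_ext (s := *:%R)).
- by split=> *; rewrite ?evalY_semilin.1 ?evalY_semilin.2 ?mulrDl ?BMW2_scalerAl.
- by split=> *; rewrite ?evalY_semilin.1 ?evalY_semilin.2 ?mulrDr ?BMW2_scalerAr.
by move=> i ik; rewrite evalYX //; apply/commr_sym/commrX.
Qed.

Lemma evalY_efun p : e * ev p * e = Af p *: e.
Proof.
move: p; apply: (semilin_ext (s := *:%R)).
- by split=> *; rewrite ?evalYD ?evalYZ -?BMW2_scalerAr -?BMW2_scalerAl ?mulrDr ?mulrDl.
- by split=> [u v|r u]; rewrite ?efunD ?efunZ ?scalerDl ?scalerA.
by move=> i ik; rewrite evalYX // efunX // eYe.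
Qed.

Let lin := (evalY_semilin.1, evalY_semilin.2, XopD, XopZ, efunD, efunZ, scalerDl, scalerDr,
  @mulrDr B, @mulrDl B).

Lemma central_evalY p : ev p * C = C * ev p.
Proof. by apply: evalY_comm; apply: central_Y. Qed.

(** Since C commutes with Y and fixes e, YXY = X^-1 C acts on p(Y) e as X^-1. *)
Lemma X_evalY_e_step p :
  X * ev (y * p) * e = Yi * (X * ev p * e - d *: (ev p * e) + (d * Af p) *: e).
Proof.
have <- : Xi * (ev p * e) = X * ev p * e - d *: (ev p * e) + (d * Af p) *: e.
  rewrite XiE mulrDl mulrBl -!BMW2_scalerAl mul1r [e * (_ * _)]mulrA evalY_efun.
  by rewrite scalerA mulrA.
rewrite -{2}central_e_left [ev p * _]mulrA central_evalY !mulrA -[Yi * Xi * _]mulrA.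
by rewrite Xi_X mulr1 Yi_Y mul1r evalY_mulX !mulrA.
Qed.

Lemma e_evalY_X_step p :
  e * ev (y * p) * X = (e * ev p * X - d *: (e * ev p) + (d * Af p) *: e) * Yi.
Proof.
have <- : e * ev p * Xi = e * ev p * X - d *: (e * ev p) + (d * Af p) *: e.
  rewrite XiE mulrDr mulrBr -!BMW2_scalerAr mulr1 evalY_efun.
  by rewrite scalerA.
have -> : e * ev p * Xi = e * ev p * (Y * X * Y).
  rewrite YXY_right [RHS]mulrA -[in RHS](mulrA e) central_evalY [e * _ in RHS]mulrA.
  by rewrite central_e_right.
rewrite -!mulrA Y_Yi mulr1 [y * p]mulrC evalYM evalYy.
by rewrite !mulrA.
Qed.

Lemma X_evalY_e p : X * ev p * e = ev (xi p) * e.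
Proof.
move: p; apply: (semilin_ext (s := *:%R)).
- by split=> *; rewrite !lin // -BMW2_scalerAr -BMW2_scalerAl.
- by split=> *; rewrite !lin // -BMW2_scalerAl.
elim=> [|i IHi] ik.
  by rewrite expr0 Xop1 evalY1 mulr1 X_e evalY_semilin.2 evalY1 -BMW2_scalerAl mul1r.
rewrite exprS X_evalY_e_step IHi ?(ltnW ik) // efunX 1?ltnW //.
rewrite -exprS (XopX ik) (XopX (ltnW ik)) /= evalYM evalYyi -mulrA; congr (_ * _).
(* An opaque scalar keeps the distributivity rules away from q - q^-1. *)
move: (d) => d0.
by rewrite evalYD evalYB !evalYZ evalY1 mulrDl mulrBl -!BMW2_scalerAl mul1r.
Qed.

Lemma e_evalY_X p : e * ev p * X = e * ev (xi p).
Proof.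
move: p; apply: (semilin_ext (s := *:%R)).
- by split=> *; rewrite !lin // -BMW2_scalerAr -BMW2_scalerAl.
- by split=> *; rewrite !lin // -BMW2_scalerAr.
elim=> [|i IHi] ik.
  by rewrite expr0 Xop1 evalY1 mulr1 e_X evalY_semilin.2 evalY1 -BMW2_scalerAr mulr1.
rewrite exprS e_evalY_X_step IHi ?(ltnW ik) // efunX 1?ltnW //.
rewrite -exprS (XopX ik) (XopX (ltnW ik)) /= [yi * _]mulrC evalYM evalYyi mulrA; congr (_ * _).
move: (d) => d0.
by rewrite evalYD evalYB !evalYZ evalY1 mulrDr mulrBr -!BMW2_scalerAr mulr1.
Qed.

(** As YX = X^-1 (XYX) and XYX commutes with Y, the left side is
    X^-1 p(Y) XY X^2; then X^2 and X^-1 are expanded by X_squared and XiE. *)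
Lemma Y_X_evalY_X p : Y * (X * ev p * X) = X * ev p * X * Y - d *: (ev p * X * Y)
   + d *: (e * ev (xi p) * Y) + d *: (Y * X * ev p) - d *: (ev (y * xi p) * e).
Proof.
have comm : ev p * (X * Y * X) = X * Y * X * ev p.
  by apply: evalY_comm; rewrite !mulrA braid.
have -> : Y * (X * ev p * X) = Xi * ev p * X * Y * (X * X).
  transitivity (Xi * (X * Y * X * ev p) * X); first by rewrite !mulrA Xi_X mul1r.
  by rewrite -comm !mulrA.
have -> : Y * X * ev p = Xi * ev p * X * Y * X.
  transitivity (Xi * (X * Y * X * ev p)); first by rewrite !mulrA Xi_X mul1r.
  by rewrite -comm !mulrA.
have <- : lambda *: (Xi * ev p * X * Y * e) = ev (y * xi p) * e.
  have XYe : X * Y * e = lambda^-1 *: (Yi * e).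
    by rewrite BMW2_scalerAr -YXYe !mulrA Yi_Y mul1r.
  rewrite -(mulrA _ X) -(mulrA _ (X * Y)) XYe -BMW2_scalerAr scalerA mulrV // scale1r.
  have -> : Xi * ev p * (Yi * e) = Xi * ev (p * yi) * e by rewrite evalYM evalYyi !mulrA.
  have <- : Y * X * Y * (ev (p * yi) * e) = Xi * ev (p * yi) * e.
    rewrite YXY_left -[LHS]mulrA [C * (_ * e)]mulrA -central_evalY.
    by rewrite -(mulrA (ev _)) central_e_left mulrA.
  rewrite mulrA -(mulrA (Y * X)) -evalY_mulX mulrCA y_inv mulr1 -(mulrA Y) -(mulrA Y).
  by rewrite X_evalY_e mulrA evalY_mulX.
rewrite X_squared mulrBr mulrDr mulr1 -!BMW2_scalerAr !scalerA.
congr (_ + _ - _); rewrite XiE !(mulrBl, mulrDl) -!BMW2_scalerAl scale1r.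
by rewrite e_evalY_X.
Qed.

(** * A spanning family of 3k^2 elements *)
Local Notation kX := (@Ordinal 3 0 erefl).
Local Notation kXX := (@Ordinal 3 1 erefl).
Local Notation ke := (@Ordinal 3 2 erefl).

Definition brick (t : 'I_3) (p p' : S) : B :=
  match val t with
  | 0 => ev p * X * ev p'
  | 1 => X * ev p * X * ev p'
  | _ => ev p * e * ev p'
  end.

Definition brick_basis (t : 'I_3 * 'I_k * 'I_k) : B :=
  brick t.1.1 (y ^+ t.1.2) (y ^+ t.2).

Local Notation sp := (in_span brick_basis).

Lemma brick_semilinl t p' : semilin *:%R (fun p => brick t p p').
Proof.
rewrite /brick; case: (val t) => [|[|n]]; split=> *;
  by rewrite ?evalYD ?evalYZ ?mulrDr ?mulrDl -?BMW2_scalerAr -?BMW2_scalerAl ?mulrDl.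
Qed.

Lemma brick_semilinr t p : semilin *:%R (fun p' => brick t p p').
Proof.
rewrite /brick; case: (val t) => [|[|n]]; split=> *;
  by rewrite ?evalYD ?evalYZ ?mulrDr ?mulrDl -?BMW2_scalerAr -?BMW2_scalerAl ?mulrDl.
Qed.

Lemma brick_in_span t p p' : sp (brick t p p').
Proof.
rewrite [p]co_expand (semilin_sum _ _ _ (brick_semilinl t p')).
apply: in_span_sum => i; rewrite (brick_semilinl t p').2; apply: in_spanZ.
rewrite [p']co_expand (semilin_sum _ _ _ (brick_semilinr t _)).
apply: in_span_sum => j; rewrite (brick_semilinr t _).2; apply: in_spanZ.
exact: (in_span_gen brick_basis (t, i, j)).
Qed.

Let b0 p p' : sp (ev p * X * ev p'). Proof. exact: (brick_in_span kX). Qed.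
Let b1 p p' : sp (X * ev p * X * ev p'). Proof. exact: (brick_in_span kXX). Qed.
Let b2 p p' : sp (ev p * e * ev p'). Proof. exact: (brick_in_span ke). Qed.

Let be1 p : sp (e * ev p). Proof. by have := b2 1 p; rewrite evalY1 mul1r. Qed.

Let sp_mull x : (forall p p', sp (x * (ev p * X * ev p'))) ->
  (forall p p', sp (x * (X * ev p * X * ev p'))) ->
  (forall p p', sp (x * (ev p * e * ev p'))) -> forall u, sp u -> sp (x * u).
Proof.
move=> h0 h1 h2 u; apply: (in_span_image (mull_semilin x)) => -[[t i] j].
by rewrite /brick_basis /brick /=; case: (val t) => [|[|n]].
Qed.

Let sp_e u : sp u -> sp (e * u).
Proof.
apply: sp_mull => p p'.
- by rewrite !mulrA e_evalY_X -!mulrA -evalYM.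
- by rewrite !mulrA e_X -!BMW2_scalerAl e_evalY_X -!mulrA -evalYM; apply: in_spanZ.
- by rewrite !mulrA evalY_efun -BMW2_scalerAl; apply: in_spanZ.
Qed.

Let sp_Y u : sp u -> sp (Y * u).
Proof.
apply: sp_mull => p p'.
- by rewrite !mulrA -evalY_mulX.
- rewrite mulrA Y_X_evalY_X !mulrDl !mulNr -!BMW2_scalerAl -!mulrA -evalY_mulX !mulrA.
  have := b0 y (p * p'); rewrite evalYy evalYM mulrA => bYX.
  have := be1 (xi p * (y * p')); rewrite evalYM mulrA => be1'.
  have := b2 (y * xi p) p' => be2.
  by do !first [apply: in_spanB | apply: in_spanD | apply: in_spanZ].
- by rewrite !mulrA -evalY_mulX.
Qed.

Let sp_X u : sp u -> sp (X * u).
Proof.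
apply: sp_mull => p p'; first by rewrite !mulrA.
  rewrite !mulrA X_squared !(mulrBl, mulrDl) -!BMW2_scalerAl scale1r e_evalY_X.
  rewrite -(mulrA e) -evalYM.
  by do !first [apply: in_spanB | apply: in_spanD | apply: in_spanZ].
by rewrite !mulrA X_evalY_e.
Qed.

(** The span is stable under left multiplication by the generators, and it
    contains 1 = X^2 - d X + d lambda e. *)
Lemma brick_spanning x : sp x.
Proof.
have sp_evY p u : sp u -> sp (ev p * u).
  move=> spu; rewrite [p]co_expand (semilin_sum _ _ _ evalY_semilin) mulr_suml.
  apply: in_span_sum => i; rewrite evalYZ -BMW2_scalerAl evalYX //; apply: in_spanZ.
  elim: (val i) => [|n IHn]; first by rewrite mul1r.
  by rewrite exprS -mulrA; apply: sp_Y.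
apply: BMW2_ind x => [|x x'|a x|g x spx]; [|exact: in_spanD|exact: in_spanZ|].
  have -> : (1 : B) = X * X - d *: X + (d * lambda) *: e.
    by rewrite X_squared addrAC subrK addrK.
  have := b0 1 1; rewrite evalY1 mul1r mulr1 => bX.
  have := b1 1 1; rewrite evalY1 !mulr1 => bXX.
  have := be1 1; rewrite evalY1 mulr1 => be1'.
  by do !first [apply: in_spanB | apply: in_spanD | apply: in_spanZ].
case: g; [exact: sp_Y| |exact: sp_X| |exact: sp_e].
  by rewrite -/Yi -evalYyi; apply: sp_evY.
rewrite -/Xi XiE mulrDl mulrBl -!BMW2_scalerAl mul1r.
by apply: in_spanD; [apply: in_spanB; [apply: sp_X|apply: in_spanZ]|apply/in_spanZ/sp_e].
Qed.

(** * The representation on a free S-module of rank 3k *)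
Section Representation.
Hypothesis x_k : \sum_(i < k) q_ i *: x_ i = x_ k.
Hypothesis delta_reg : GRing.lreg (delta q).

Let d : S := in_alg S (delta q).
Let l : S := in_alg S lambda.
Let li : S := in_alg S lambda^-1.
Let E p : S := in_alg S (Af p).

Let scaleE r p : r *: p = in_alg S r * p. Proof. by rewrite mulr_algl. Qed.
Let l_li : l * li = 1.
Proof. by rewrite /l /li -(rmorphM (in_alg S)) mulrV ?rmorph1. Qed.
Let li_E : li = l - d + d * E 1.
Proof.
rewrite /li /E efun1 /l /d -(rmorphM (in_alg S)) -(rmorphB (in_alg S)) -(rmorphD (in_alg S)).
by rewrite lambda_inv.
Qed.
Let xi_1 : xi 1 = l. Proof. exact: Xop1. Qed.
Let xi_y : y * xi y = li. Proof. exact: (Xop_y x_k). Qed.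
Let xi_yp p : y * xi (y * p) = xi p - d * p + d * E p.
Proof.
rewrite (Xop_mulX x_k) /d /E.
by rewrite -(rmorphM (in_alg S)) mulr_algl.
Qed.
Let E_xi p : E (xi p) = l * E p.
Proof.
rewrite /E (efun_Xop x_k delta_reg).
by rewrite rmorphM.
Qed.
Let xi_yxiy p : xi (y * xi (y * p)) = p.
Proof. exact: (Xop_y_Xop_y x_k delta_reg). Qed.
Let y_xiyxi p : y * xi (y * xi p) = p.
Proof.
rewrite -{1}[p]mul1r -y_inv mulrAC -mulrA xi_yxiy mulrC -mulrA.
by rewrite [yi * y]mulrC y_inv mulr1.
Qed.

Let J : finType := ('I_3 * 'I_k)%type.
Let n := #|J|.
Local Notation V := 'cV[S]_n.

(** The column unitvec t p stands for p(Y) X, X p(Y) X or p(Y) e according to t,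
    and the scalar s in S for right multiplication by s(Y). *)
Definition unitvec (t : 'I_3) (p : S) : V :=
  \col_(m < n) (((enum_val m).1 == t)%:R * (co (enum_val m).2 p)%:A).

Let sS (r : R) (v : V) : V := r%:A *: v.

Let sSD r : {morph sS r : v w / v + w}. Proof. by move=> v w; apply: scalerDr. Qed.

Definition opmx (F : 'I_3 -> S -> V) : 'M[S]_n :=
  \matrix_(i < n, m < n) (F (enum_val m).1 (y ^+ (enum_val m).2) i 0).

Lemma opmxE (F : 'I_3 -> S -> V) t p : semilin sS (F t) -> opmx F *m unitvec t p = F t p.
Proof.
move=> FL; apply/colP => i; rewrite mxE {2}[p]co_expand (semilin_sum _ _ _ FL) summxE.
under eq_bigr do rewrite !mxE.
rewrite -(big_enum_val (fun j : J =>
  F j.1 (y ^+ j.2) i 0 * ((j.1 == t)%:R * (co j.2 p)%:A))).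
transitivity (\sum_(s < 3) \sum_(j < k)
    F s (y ^+ j) i 0 * ((s == t)%:R * (co j p)%:A)).
  by rewrite pair_big; apply: eq_bigl.
rewrite (bigD1 t) //= [X in _ + X]big1 => [|s /negPf st]; last first.
  by rewrite big1 // => j _; rewrite st mul0r mulr0.
rewrite addr0; apply: eq_bigr => j _.
by rewrite eqxx mul1r FL.2 mxE mulrC.
Qed.

Lemma mx_eq_on_units (P Q : 'M[S]_n) :
  (forall t p, P *m unitvec t p = Q *m unitvec t p) -> P = Q.
Proof.
move=> PQ; apply/matrixP => i m.
have E0 : unitvec (enum_val m).1 (y ^+ (enum_val m).2) = delta_mx m 0.
  apply/colP => m'; rewrite !mxE coX // -(inj_eq enum_val_inj).
  rewrite -[(enum_val m' == _)]/((_ == _) && (_ == _)) andbT.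
  by case: (_ == _) => /=; rewrite ?mul1r ?mul0r // -in_algE rmorph_nat.
have /colP/(_ i) := PQ (enum_val m).1 (y ^+ (enum_val m).2).
by rewrite E0 -!colE !mxE.
Qed.

Lemma unitvecD t p p' : unitvec t (p + p') = unitvec t p + unitvec t p'.
Proof. by apply/colP => m; rewrite !mxE linearD scalerDl mulrDr. Qed.

Lemma unitvecZ t r p : unitvec t (r *: p) = r%:A *: unitvec t p.
Proof. by apply/colP => m; rewrite !mxE linearZ /= -scalerA scaleE mulrCA. Qed.

Lemma unitvec_semilin t : semilin sS (unitvec t).
Proof. by split=> [p p'|r p]; rewrite ?unitvecD ?unitvecZ. Qed.

Local Notation va := (unitvec kX).
Local Notation vb := (unitvec kXX).
Local Notation vc := (unitvec ke).

Definition by_kind (Fa Fb Fc : S -> V) (t : 'I_3) : S -> V :=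
  match val t with 0 => Fa | 1 => Fb | _ => Fc end.

Lemma by_kindP (P : 'I_3 -> Prop) :
  P kX -> P kXX -> P ke -> forall t, P t.
Proof.
move=> Pa Pb Pc; case=> [[|[|[|m]]] lt_m] //.
- by rewrite (_ : Ordinal _ = kX) //; apply: val_inj.
- by rewrite (_ : Ordinal _ = kXX) //; apply: val_inj.
- by rewrite (_ : Ordinal _ = ke) //; apply: val_inj.
Qed.

(* Left multiplication of X p(Y) X by Y, as in Y_X_evalY_X, and by X, as in
   X_squared; p(Y) X e and e p(Y) X are rewritten by means of xi. *)
Let Yb p : V := y *: vb p - (d * y) *: va p + (d * (xi p * y)) *: vc 1
  + (d * p) *: va y - d *: vc (y * xi p).
Let Xb p : V := va p + d *: vb p - (d * l * xi p) *: vc 1.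

Definition Ymx := opmx (by_kind (fun p => va (y * p)) Yb (fun p => vc (y * p))).
Definition Xmx := opmx (by_kind vb Xb (fun p => vc (xi p))).
Definition emx := opmx (by_kind (fun p => xi p *: vc 1) (fun p => (l * xi p) *: vc 1)
  (fun p => E p *: vc 1)).

Let semilin_vec t (L : S -> S) : semilin *:%R L -> semilin sS (fun p => unitvec t (L p)).
Proof. by move=> LL; apply: semilin_pre LL (unitvec_semilin t). Qed.

Let semilin_scal (L : S -> S) v : semilin *:%R L -> semilin sS (fun p => L p *: v).
Proof. by move=> [LD LZ]; split=> [p p'|r p]; rewrite ?LD ?LZ ?scalerDl // /sS scalerA scaleE. Qed.

Let semilin_scale c (F : S -> V) : semilin sS F -> semilin sS (fun p => c *: F p).
Proof. by move=> [FD FZ]; split=> [p p'|r p]; rewrite ?FD ?FZ ?scalerDr // /sS !scalerA mulrC. Qed.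

Let semilinM c (L : S -> S) : semilin *:%R L -> semilin *:%R (fun p => c * L p).
Proof. by move=> [LD LZ]; split=> *; rewrite ?LD ?LZ ?mulrDr ?scalerAr. Qed.

Let semilinMr c (L : S -> S) : semilin *:%R L -> semilin *:%R (fun p => L p * c).
Proof. by move=> [LD LZ]; split=> *; rewrite ?LD ?LZ ?mulrDl ?scalerAl. Qed.

Let semilin_id : semilin *:%R (fun p : S => p). Proof. by []. Qed.
Let semilin_xi : semilin *:%R xi. Proof. exact: Xop_semilin. Qed.
Let semilin_E : semilin *:%R E.
Proof.
by split=> [p p'|r p]; rewrite /E ?efunD ?efunZ ?rmorphD ?rmorphM // scaleE.
Qed.

Ltac semilin_tac := repeat first
  [ exact: semilin_id | exact: semilin_xi | exact: semilin_E
  | apply: semilinM | apply: semilinMr | apply: semilin_vec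
  | apply: semilin_scal | apply: semilin_scale
  | apply: (semilinN sSD) | apply: (semilinD sSD) ].

Let by_kind_semilin Fa Fb Fc t : semilin sS Fa -> semilin sS Fb -> semilin sS Fc ->
  semilin sS (by_kind Fa Fb Fc t).
Proof. by rewrite /by_kind; case: (val t) => [|[]]. Qed.

Let Yb_semilin : semilin sS Yb. Proof. by rewrite /Yb; semilin_tac. Qed.
Let Xb_semilin : semilin sS Xb. Proof. by rewrite /Xb; semilin_tac. Qed.

Let Y_a p : Ymx *m va p = va (y * p).
Proof. by rewrite opmxE //; apply: by_kind_semilin => //; semilin_tac. Qed.
Let Y_b p : Ymx *m vb p = Yb p.
Proof. by rewrite opmxE //; apply: by_kind_semilin => //; semilin_tac. Qed.
Let Y_c p : Ymx *m vc p = vc (y * p).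
Proof. by rewrite opmxE //; apply: by_kind_semilin => //; semilin_tac. Qed.
Let X_a p : Xmx *m va p = vb p.
Proof. by rewrite opmxE //; apply: by_kind_semilin => //; semilin_tac. Qed.
Let X_b p : Xmx *m vb p = Xb p.
Proof. by rewrite opmxE //; apply: by_kind_semilin => //; semilin_tac. Qed.
Let X_c p : Xmx *m vc p = vc (xi p).
Proof. by rewrite opmxE //; apply: by_kind_semilin => //; semilin_tac. Qed.
Let e_a p : emx *m va p = xi p *: vc 1.
Proof. by rewrite opmxE //; apply: by_kind_semilin => //; semilin_tac. Qed.
Let e_b p : emx *m vb p = (l * xi p) *: vc 1.
Proof. by rewrite opmxE //; apply: by_kind_semilin => //; semilin_tac. Qed.
Let e_c p : emx *m vc p = E p *: vc 1.
Proof. by rewrite opmxE //; apply: by_kind_semilin => //; semilin_tac. Qed.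

Let vecN t p : unitvec t (- p) = - unitvec t p.
Proof. by rewrite -scaleN1r unitvecZ scaleN1r scaleN1r. Qed.
Let vec_alg t r : unitvec t (in_alg S r) = in_alg S r *: unitvec t 1.
Proof. exact: unitvecZ. Qed.
Let vec_algM t r p : unitvec t (in_alg S r * p) = in_alg S r *: unitvec t p.
Proof. by rewrite mulr_algl unitvecZ. Qed.
Let xi_algM r p : xi (in_alg S r * p) = in_alg S r * xi p.
Proof. by rewrite mulr_algl XopZ mulr_algl. Qed.

Let vD (u v : V) i : (u + v) i 0 = u i 0 + v i 0. Proof. by rewrite mxE. Qed.
Let vN (u : V) i : (- u) i 0 = - u i 0. Proof. by rewrite mxE. Qed.
Let vZ s (u : V) i : (s *: u) i 0 = s * u i 0. Proof. by rewrite mxE. Qed.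
Ltac vring := apply/colP => ?; rewrite !(vD, vN, vZ); ring.

Let mulmxN1 (P : 'M[S]_n) (u : V) : P *m (- u) = - (P *m u). Proof. exact: mulmxN. Qed.
Let actE := (@mulmxDr S n n 1, mulmxN1, Y_a, Y_b, Y_c, X_a, X_b, X_c, e_a, e_b, e_c).
Let actZ (P : 'M[S]_n) s (u : V) : P *m (s *: u) = s *: (P *m u).
Proof. by rewrite scalemxAr. Qed.

Let lE : l * E 1 * d = d * l - l * l + 1.
Proof.
have -> : l * E 1 * d = l * (l - d + d * E 1) - l * l + d * l by ring.
by rewrite -li_E l_li; ring.
Qed.

Lemma Xmx_emx : Xmx *m emx = l *: emx.
Proof.
apply: mx_eq_on_units; apply: by_kindP => p;
  by rewrite -mulmxA -scalemxAl !actE !actZ X_c xi_1 -[l]mulr1 vec_algM !scalerA mulr1 mulrC.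
Qed.

Lemma emx_Xmx : emx *m Xmx = l *: emx.
Proof.
apply: mx_eq_on_units; apply: by_kindP => p; rewrite -mulmxA -scalemxAl !actE.
- by rewrite scalerA.
- rewrite !actZ !actE; apply/colP => i; rewrite !(vD, vN, vZ).
  transitivity (xi p * vc 1 i 0 * (1 + d * l - l * E 1 * d)); first by ring.
  by rewrite lE; ring.
- by rewrite E_xi scalerA.
Qed.

Let xi_xi p : xi (xi p) = p + d * xi p - d * (l * E p).
Proof.
have := xi_yxiy p; rewrite xi_yp /d /E.
rewrite !XopD -scaleN1r XopZ scaleN1r !xi_algM -[in_alg S (Af p)]mulr1 xi_algM.
by rewrite xi_1 => {2}<-; ring.
Qed.

Lemma Xmx_sq : Xmx *m Xmx = 1%:M + d *: Xmx - (d * l) *: emx.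
Proof.
apply: mx_eq_on_units; apply: by_kindP => p;
  rewrite -mulmxA !(mulmxDl, mulNmx) mul1mx -!scalemxAl !actE.
- by rewrite /Xb; vring.
- rewrite !actZ !actE xi_1 -[l]mulr1 vec_algM /Xb !mulr1; vring.
- by rewrite xi_xi !unitvecD vecN !vec_algM vec_alg; vring.
Qed.

Definition Ximx := Xmx - d%:M + d *: emx.

Let XXi : Xmx *m Ximx = 1%:M.
Proof.
rewrite /Ximx mulmxDr mulmxBr Xmx_sq mul_mx_scalar -scalemxAr Xmx_emx scalerA.
by rewrite addrAC subrK addrK.
Qed.

Let XiX : Ximx *m Xmx = 1%:M.
Proof.
rewrite /Ximx mulmxDl mulmxBl Xmx_sq mul_scalar_mx -scalemxAl emx_Xmx scalerA.
by rewrite addrAC subrK addrK.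
Qed.

Let YXY_c p : Ymx *m (Xmx *m (Ymx *m vc p)) = vc (xi p) - d *: vc p + (d * E p) *: vc 1.
Proof.
rewrite !actE xi_yp unitvecD unitvecD vecN -[E p]mulr1 !vec_algM mulr1.
by rewrite scalerA.
Qed.

Let XYXY_c p : Xmx *m (Ymx *m (Xmx *m (Ymx *m vc p))) = vc p.
Proof. by rewrite !actE xi_yxiy. Qed.

Let YXYX_c p : Ymx *m (Xmx *m (Ymx *m (Xmx *m vc p))) = vc p.
Proof. by rewrite !actE y_xiyxi. Qed.

Let XY_b p : Xmx *m (Ymx *m vb p)
  = y *: va p + (d * p) *: vb y - d *: vc (xi (y * xi p)).
Proof.
rewrite Y_b /Yb !actE !actZ !actE xi_1 -[l]mulr1 vec_algM /Xb; vring.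
Qed.

Let XYXY_a p : Xmx *m (Ymx *m (Xmx *m (Ymx *m va p)))
  = y *: va (y * p) + (d * (y * p)) *: vb y - d *: vc p.
Proof. by rewrite Y_a X_a XY_b xi_yxiy. Qed.

Let Y_by : Ymx *m vb y = y *: vb y.
Proof.
rewrite Y_b /Yb xi_y -[li]mulr1 vec_algM.
have -> : (d * (xi y * y)) = d * li by rewrite mulrC [_ * y]mulrC xi_y mulrC.
vring.
Qed.

Let YXYX_a p : Ymx *m (Xmx *m (Ymx *m (Xmx *m va p)))
  = y *: va (y * p) + (d * (y * p)) *: vb y - d *: vc p.
Proof.
by rewrite X_a XY_b !(@mulmxDr S n n 1, mulmxN1) !actZ Y_by Y_a Y_c y_xiyxi; vring.
Qed.

Let YXY_e1 : Ymx *m (Xmx *m (Ymx *m vc 1)) = li *: vc 1.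
Proof. by rewrite YXY_c xi_1 -[l]mulr1 vec_algM li_E; vring. Qed.

Let E_Z p : E (y * xi (y * p)) = li * E p.
Proof.
rewrite xi_yp; have -> : xi p - d * p + d * E p = xi p - delta q *: p + (delta q * Af p) *: 1.
  by rewrite !scaleE rmorphM mulr1.
rewrite !semilin_E.1 -scaleN1r !semilin_E.2 !scaleE -/d E_xi li_E.
rewrite (rmorphM (in_alg S)) -/d -/(E p) rmorphN1; ring.
Qed.

Let eYXY_a p : emx *m (Ymx *m (Xmx *m (Ymx *m va p))) = (li * xi p) *: vc 1.
Proof.
rewrite Y_a X_a Y_b /Yb !actE !actZ !actE E_Z.
rewrite !scalerA -scalerBl -!scalerDl -scalerBl; congr (_ *: _).
transitivity (y * xi (y * p) * (l - d + d * E 1) + d * p * (y * xi y) - d * (li * E p)).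
  by ring.
by rewrite -li_E xi_y xi_yp; ring.
Qed.

Let eYXY_c p : emx *m (Ymx *m (Xmx *m (Ymx *m vc p))) = (li * E p) *: vc 1.
Proof. by rewrite !actE E_Z. Qed.

(** For the columns vb p = X va p the braid identity on va p is used: there
    eYXY X = e XYXY = lambda eYXY. *)
Lemma emx_YXY : emx *m Ymx *m Xmx *m Ymx = li *: emx.
Proof.
apply: mx_eq_on_units; apply: by_kindP => p; rewrite -!mulmxA -scalemxAl.
- by rewrite eYXY_a e_a scalerA.
- rewrite -X_a YXYX_a -XYXY_a !mulmxA emx_Xmx -!mulmxA -scalemxAl eYXY_a.
  by rewrite -scalemxAl e_a !scalerA; congr (_ *: _); ring.
- by rewrite eYXY_c e_c scalerA.
Qed.

Lemma YXY_emx : Ymx *m Xmx *m Ymx *m emx = li *: emx.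
Proof.
by apply: mx_eq_on_units; apply: by_kindP => p; rewrite -!mulmxA -scalemxAl !(e_a, e_b, e_c)
  !actZ YXY_e1 !scalerA mulrC.
Qed.

(** On vb p = X va p, both XYXY X = X YXYX and YXYX X = YXY X^2 are reduced to
    identities on va p by expanding X^2. *)
Lemma braid_mx : Xmx *m Ymx *m Xmx *m Ymx = Ymx *m Xmx *m Ymx *m Xmx.
Proof.
apply: mx_eq_on_units; apply: by_kindP => p; rewrite -!mulmxA.
- by rewrite XYXY_a YXYX_a.
- rewrite -X_a YXYX_a -XYXY_a.
  transitivity (Xmx *m Xmx *m (Ymx *m (Xmx *m (Ymx *m va p)))).
    by rewrite !mulmxA.
  transitivity (Ymx *m (Xmx *m (Ymx *m (Xmx *m Xmx *m va p)))); last by rewrite !mulmxA.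
  rewrite Xmx_sq !(mulmxDl, mulNmx) !mul1mx -!scalemxAl eYXY_a e_a.
  rewrite !(@mulmxDr S n n 1, mulmxN1) !actZ YXY_e1.
  by rewrite XYXY_a YXYX_a !scalerA; congr (_ - _ *: _); ring.
- by rewrite XYXY_c YXYX_c.
Qed.

Lemma emx_Ypow m : (m < k)%N -> emx *m Ymx ^+ m *m emx = in_alg S (A m) *: emx.
Proof.
move=> mk.
have Ym : Ymx ^+ m *m vc 1 = vc (y ^+ m).
  elim: m {mk} => [|m IHm]; first by rewrite mul1mx.
  by rewrite exprS -mulmxA IHm Y_c -exprS.
have eYm : emx *m (Ymx ^+ m *m vc 1) = in_alg S (A m) *: vc 1.
  by rewrite Ym e_c /E efunX.
by apply: mx_eq_on_units; apply: by_kindP => p; rewrite -!mulmxA -scalemxAl !(e_a, e_b, e_c)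
  !actZ eYm !scalerA mulrC.
Qed.

(* Vectors annihilated by f(Y).  They contain all va p and vc p, on which Y acts
   by y, and the vectors with Yv = yv.  The columns vb p are reached as follows:
   if Y vb p = y vb p + (Y - y) w with w annihilated by f(Y), then Y multiplies
   vb p - w by the scalar y. *)
Let killed (v : V) := Ymx ^+ k *m v = \sum_(i < k) in_alg S (q_ i) *: (Ymx ^+ i *m v).

Let killedD v w : killed v -> killed w -> killed (v + w).
Proof.
rewrite /killed => kv kw; rewrite mulmxDr kv kw -big_split; apply: eq_bigr => i _.
by rewrite mulmxDr scalerDr.
Qed.

Let killedZ s v : killed v -> killed (s *: v).
Proof.
rewrite /killed => kv; rewrite actZ kv scaler_sumr; apply: eq_bigr => i _.
by rewrite actZ !scalerA mulrC.
Qed.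

Let killed_eigen v : Ymx *m v = y *: v -> killed v.
Proof.
move=> Yv; have Yn m : Ymx ^+ m *m v = y ^+ m *: v.
  elim: m => [|m IHm]; first by rewrite mul1mx scale1r.
  by rewrite exprSr -mulmxA Yv actZ IHm scalerA -exprS.
rewrite /killed Yn y_root scaler_suml; apply: eq_bigr => i _.
by rewrite Yn scaleE scalerA.
Qed.

Let killed_shift t p : (forall p, Ymx *m unitvec t p = unitvec t (y * p)) ->
  killed (unitvec t p).
Proof.
move=> Yt; have Yn m : Ymx ^+ m *m unitvec t p = unitvec t (y ^+ m * p).
  elim: m => [|m IHm]; first by rewrite mul1mx mul1r.
  by rewrite exprS -mulmxA IHm Yt mulrA -exprS.
rewrite /killed Yn y_root mulr_suml (semilin_sum _ _ _ (unitvec_semilin t)).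
by apply: eq_bigr => i _; rewrite Yn -scalerAl unitvecZ.
Qed.

Let shifted (v : V) := exists2 w, killed w & v = Ymx *m w - y *: w.

Let shiftedD v w : shifted v -> shifted w -> shifted (v + w).
Proof.
move=> [v' kv ->] [w' kw ->]; exists (v' + w'); first exact: killedD.
by rewrite mulmxDr scalerDr opprD addrACA.
Qed.

Let shiftedZ s v : shifted v -> shifted (s *: v).
Proof.
move=> [v' kv ->]; exists (s *: v'); first exact: killedZ.
by rewrite actZ scalerBr !scalerA [y * s]mulrC.
Qed.

Let shifted_diag t p : (forall p, Ymx *m unitvec t p = unitvec t (y * p)) ->
  shifted (unitvec t p - p *: unitvec t 1).
Proof.
move=> Yt; have main m : shifted (unitvec t (y ^+ m) - y ^+ m *: unitvec t 1).
  elim: m => [|m IHm].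
    rewrite expr0 scale1r subrr; exists 0; last by rewrite mulmx0 scaler0 subrr.
    by rewrite -(scale0r (unitvec t 1)); apply/killedZ/killed_shift.
  have -> : unitvec t (y ^+ m.+1) - y ^+ m.+1 *: unitvec t 1
     = (Ymx *m unitvec t (y ^+ m) - y *: unitvec t (y ^+ m))
       + y *: (unitvec t (y ^+ m) - y ^+ m *: unitvec t 1).
    by rewrite Yt -exprS [y ^+ m.+1 in X in _ - X]exprS; vring.
  by apply: shiftedD; [exists (unitvec t (y ^+ m)) => //; apply: killed_shift | apply: shiftedZ].
have F_semilin : semilin sS (fun p => unitvec t p - p *: unitvec t 1) by semilin_tac.
rewrite [p]co_expand (semilin_sum _ _ _ F_semilin); apply: big_ind => [|v w|i _].
- by rewrite -(scale0r (unitvec t (y ^+ 0) - y ^+ 0 *: unitvec t 1)); apply: shiftedZ.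
- exact: shiftedD.
by rewrite F_semilin.2; apply: shiftedZ.
Qed.

Let killed_b p : killed (vb p).
Proof.
have [w kw Ww] : shifted (d *: (p *: (va y - y *: va 1) + (- y) *: (va p - p *: va 1)
    + -1 *: (vc (y * xi p) - (y * xi p) *: vc 1))).
  apply/shiftedZ/shiftedD/shiftedZ/shifted_diag/Y_c.
  by apply/shiftedD; apply/shiftedZ/shifted_diag/Y_a.
rewrite -(subrK w (vb p)); apply: killedD => //; apply: killed_eigen.
rewrite mulmxDr mulmxN1 scalerBr Y_b.
have -> : Ymx *m w = d *: (p *: (va y - y *: va 1) + (- y) *: (va p - p *: va 1)
    + -1 *: (vc (y * xi p) - (y * xi p) *: vc 1)) + y *: w by rewrite Ww subrK.
by rewrite /Yb; vring.
Qed.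

Lemma Ymx_root : Ymx ^+ k = \sum_(i < k) in_alg S (q_ i) *: Ymx ^+ i.
Proof.
apply: mx_eq_on_units => t p; rewrite mulmx_suml.
under eq_bigr do rewrite -scalemxAl.
move: t; apply: by_kindP; [apply/killed_shift/Y_a | exact: killed_b | apply/killed_shift/Y_c].
Qed.

(** The relation on Y and Y^-1 is met by the inverse that cyclo_inv extracts from
    f(Y) = 0, and the one on X and X^-1 by X - d + d e. *)
Lemma representation : exists rho : {rmorphism B -> 'M[S]_n},
  [/\ forall a x, rho (a *: x) = in_alg S a *: rho x,
      rho Y = Ymx, rho X = Xmx & rho e = emx].
Proof.
have [phi phiE] : exists phi : {rmorphism R -> 'M[S]_n}, forall a P, phi a * P = in_alg S a *: P.
  exists (@scalar_mx S n \o in_alg S : {rmorphism _ -> _}) => a P.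
  by rewrite -mul_scalar_mx.
have phiC a P : phi a * P = P * phi a.
  have <- : in_alg S a *: (1 : 'M[S]_n) = phi a by rewrite -phiE mulr1.
  by rewrite -[LHS]/(_ *m _) -[RHS]/(_ *m _) -scalemxAl -scalemxAr mul1mx mulmx1.
have [Yimx [YYi YiY]] : exists Z, Ymx * Z = 1 /\ Z * Ymx = 1.
  apply: (cyclo_inv k_gt0 q0_unit phiC); rewrite Ymx_root.
  by apply: eq_bigr => i _; rewrite phiE.
pose f g := match g with GY => Ymx | GYi => Yimx | GX => Xmx | GXi => Ximx | Ge => emx end.
have frel t u : bmw_rel k q lambda q_ A t u -> term_eval phi f t = term_eval phi f u.
  have pow s m : term_eval phi f (tpow s m) = term_eval phi f s ^+ m.
    elim: m => [|m IHm] /=; first by rewrite rmorph1 expr0.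
    by rewrite IHm exprS.
  case=> /=.
  - by rewrite YYi rmorph1.
  - by rewrite YiY rmorph1.
  - by rewrite rmorph1; apply: XXi.
  - by rewrite rmorph1; apply: XiX.
  - rewrite pow Ymx_root (big_morph (term_eval phi f) (fun _ _ => erefl _)
      (rmorph0 phi : term_eval phi f (Const _ 0) = 0)).
    by apply: eq_bigr => i _ /=; rewrite pow phiE.
  - rewrite rmorph1 rmorphN1 !phiE.
    rewrite mulN1r -[Xmx - Ximx]/(Xmx + - Ximx) /Ximx scalerDr.
    by rewrite mulN1r scalerN -scalemx1 opprD opprB addrA addrCA subrr addr0.
  - exact: braid_mx.
  - by rewrite phiE; apply: Xmx_emx.
  - by rewrite phiE; apply: emx_Xmx.
  - by rewrite phiE; apply: YXY_emx.
  - by rewrite phiE; apply: emx_YXY.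
  - by move=> m mk; rewrite pow phiE; apply: emx_Ypow.
have [F [FZ Fg]] := presented_alg_lift phiC frel.
exists F; split=> [a x||| ]; last 3 first; try exact: Fg.
by rewrite FZ phiE.
Qed.

(** The vector w below stands for 1 = X^2 - d X + d lambda e.  It satisfies
    Yw = yw, Xw = va 1 and ew = vc 1, so the spanning family sends it to the
    vectors y^j unitvec t (y^i). *)
Lemma brick_basis_free (c : 'I_3 * 'I_k * 'I_k -> R) :
  \sum_t c t *: brick_basis t = 0 -> forall t, c t = 0.
Proof.
have [rho [rhoZ rhoY rhoX rhoe]] := representation.
pose w : V := vb 1 - d *: va 1 + (d * l) *: vc 1.
have Xw : Xmx *m w = va 1.
  rewrite /w !actE !actZ !actE xi_1 /Xb xi_1 -[l]mulr1 !vec_algM !mulr1; vring.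
have Yw : Ymx *m w = y *: w.
  rewrite /w !actE !actZ !actE /Yb xi_1 !mulr1 [y * l]mulrC vec_algM; vring.
have ew : emx *m w = vc 1.
  rewrite /w !actE !actZ !actE xi_1; apply/colP => i; rewrite !(vD, vN, vZ).
  transitivity (vc 1 i 0 * (l * (l - d + d * E 1))); first by ring.
  by rewrite -li_E l_li mulr1.
have rhoY_pow m : rho (Y ^+ m) = Ymx ^+ m by rewrite rmorphXn rhoY.
have ev_w p : rho (ev p) *m w = p *: w.
  move: p; apply: (semilin_ext (s := sS)).
  - by split=> *; rewrite ?evalYD ?evalYZ ?rmorphD ?rhoZ ?mulmxDl -?scalemxAl.
  - by split=> *; rewrite ?scalerDl // /sS scalerA mulr_algl.
  move=> i ik; rewrite (evalYX ik) rhoY_pow.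
  elim: i {ik} => [|i IHi]; first by rewrite mul1mx scale1r.
  by rewrite exprSr -mulmxA Yw actZ IHi scalerA -exprS.
have ev_t t p : (forall p, Ymx *m unitvec t p = unitvec t (y * p)) ->
    rho (ev p) *m unitvec t 1 = unitvec t p.
  move=> Yt; move: p; apply: (semilin_ext (s := sS)).
  - by split=> *; rewrite ?evalYD ?evalYZ ?rmorphD ?rhoZ ?mulmxDl -?scalemxAl.
  - exact: unitvec_semilin.
  move=> i ik; rewrite (evalYX ik) rhoY_pow.
  elim: i {ik} => [|i IHi]; first by rewrite mul1mx.
  by rewrite exprS -mulmxA IHi Yt -exprS.
have brickE t p p' : rho (brick t p p') *m w = p' *: unitvec t p.
  move: t; apply: by_kindP; rewrite /brick /= !rmorphM ?rhoX ?rhoe -!mulmxA ev_w !actZ.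
  - by rewrite Xw ev_t //; apply: Y_a.
  - by rewrite Xw ev_t ?X_a //; apply: Y_a.
  - by rewrite ew ev_t //; apply: Y_c.
move=> /(congr1 (fun x => rho x *m w)); rewrite rmorph0 mul0mx rmorph_sum mulmx_suml => c0.
case=> [[t i] j]; move: j; apply: S_powers_free.
have /colP/(_ (enum_rank (t, i))) := c0; rewrite summxE mxE => c0i; rewrite -[RHS]c0i {c0i}.
transitivity (\sum_(ti : 'I_3 * 'I_k) \sum_(j < k)
    (rho (c (ti, j) *: brick_basis (ti, j)) *m w) (enum_rank (t, i)) 0); last first.
  by rewrite pair_big; apply: eq_big => [[]|[]].
rewrite (bigD1 (t, i)) //= [X in _ + X]big1 ?addr0 => [|[t' i'] ti].
  apply: eq_bigr => j _; rewrite rhoZ -scalemxAl brickE scalerA vZ mxE enum_rankK /=.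
  by rewrite eqxx coX // eqxx mul1r scale1r !mulr1 mulr_algl.
apply: big1 => j _; rewrite rhoZ -scalemxAl brickE scalerA vZ mxE enum_rankK /= coX //.
have [tt'|] := eqVneq t t'; last by rewrite mul0r mulr0.
have [ii'|] := eqVneq (i : nat) i'; last by rewrite scale0r !mulr0.
by case/eqP: ti; rewrite tt' (val_inj ii').
Qed.

End Representation.

(** * The left ideal of e as a module *)

(** A copy of S without scalars, to carry the module structure over the algebra
    in which p stands for p(Y) e. *)
Definition ideal_carrier : Type := S.
HB.instance Definition _ := GRing.Zmodule.on ideal_carrier.

Section IdealModule.
Hypothesis Ye_free : lin_indep (fun i : 'I_k => Y ^+ i * e).

Lemma evalYe_inj p p' : ev p * e = ev p' * e -> p = p'.
Proof.
move=> pp'; apply/eqP; rewrite -subr_eq0; apply/eqP.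
have : ev (p - p') * e = 0 by rewrite evalYB mulrBl pp' subrr.
rewrite /evalY /lext mulr_suml.
under eq_bigr do rewrite -BMW2_scalerAl.
by move/Ye_free => c0; rewrite [LHS]co_expand big1 // => i _; rewrite c0 scale0r.
Qed.

Lemma ideal_stable (x : B) p : exists p', x * (ev p * e) = ev p' * e.
Proof.
move: x p; apply: BMW2_ind => [|x x' IHx IHx'|a x IHx|g x IHx] p.
- by exists p; rewrite mul1r.
- have [[u xu] [u' xu']] := (IHx p, IHx' p).
  by exists (u + u'); rewrite mulrDl xu xu' evalYD mulrDl.
- by have [u xu] := IHx p; exists (a *: u); rewrite -BMW2_scalerAl xu evalYZ BMW2_scalerAl.
have [u xu] := IHx p; rewrite -mulrA xu {x p xu IHx}.
have eu : e * (ev u * e) = ev (Af u)%:A * e.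
  by rewrite mulrA evalY_efun // evalYZ evalY1 -BMW2_scalerAl mul1r.
have Xu : X * (ev u * e) = ev (xi u) * e by rewrite mulrA X_evalY_e.
case: g.
- by exists (y * u); rewrite evalY_mulX // mulrA.
- by exists (yi * u); rewrite evalYM evalYyi // mulrA.
- by exists (xi u).
- exists (xi u - d *: u + d *: (Af u)%:A).
  rewrite -/Xi XiE mulrDl mulrBl -!BMW2_scalerAl mul1r Xu eu.
  rewrite evalYD evalYB ![ev (d *: _)]evalYZ [RHS]mulrDl [X in _ = X + _]mulrBl.
  by rewrite -!BMW2_scalerAl.
- by exists (Af u)%:A.
Qed.

Definition ideal_act (x : B) (p : S) : S := projT1 (cid (ideal_stable x p)).

Lemma ideal_actP x p p' : x * (ev p * e) = ev p' * e -> ideal_act x p = p'.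
Proof.
by move=> xp; apply: evalYe_inj; rewrite /ideal_act; case: cid => u /= <-.
Qed.

Lemma ideal_actE x p : x * (ev p * e) = ev (ideal_act x p) * e.
Proof. by rewrite /ideal_act; case: cid. Qed.

Fact ideal_actA x x' p : ideal_act x (ideal_act x' p) = ideal_act (x * x') p.
Proof. by apply: ideal_actP; rewrite -!ideal_actE -mulrA. Qed.
Fact ideal_act1 : left_id 1 ideal_act.
Proof. by move=> p; apply: ideal_actP; rewrite mul1r. Qed.
Fact ideal_actDr : right_distributive ideal_act +%R.
Proof. by move=> x p p'; apply: ideal_actP; rewrite !evalYD !mulrDl mulrDr !ideal_actE. Qed.
Fact ideal_actDl p : {morph ideal_act^~ p : x x' / x + x'}.
Proof. by move=> x x'; apply: ideal_actP; rewrite evalYD !mulrDl !ideal_actE. Qed.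

Lemma ideal_module : exists (V : lmodType B) (f : S -> restr V),
  [/\ semilin *:%R f, bijective f & forall x p, act x (f p) = f (ideal_act x p)].
Proof.
pose V : lmodType B := HB.pack ideal_carrier
  (GRing.Zmodule_isLmodule.Build B ideal_carrier
    ideal_actA ideal_act1 ideal_actDr ideal_actDl).
exists V, (fun p => p); split=> //; last by exists (fun p => p).
split=> // r p; apply/esym/ideal_actP.
by rewrite -BMW2_scalerAl mul1r evalYZ BMW2_scalerAl.
Qed.

Lemma ideal_actY p : ideal_act Y p = y * p.
Proof. by apply: ideal_actP; rewrite evalY_mulX mulrA. Qed.
Lemma ideal_actYi p : ideal_act Yi p = yi * p.
Proof. by apply: ideal_actP; rewrite evalYM evalYyi mulrA. Qed.
Lemma ideal_actX p : ideal_act X p = xi p.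
Proof. by apply: ideal_actP; rewrite mulrA X_evalY_e. Qed.
Lemma ideal_act_e p : ideal_act e p = (Af p)%:A.
Proof. by apply: ideal_actP; rewrite mulrA evalY_efun evalYZ evalY1 -BMW2_scalerAl mul1r. Qed.

Lemma ideal_actYX n p : ideal_act (Y ^+ n) p = y ^+ n * p.
Proof.
elim: n => [|n IHn]; first by rewrite ideal_act1 mul1r.
by rewrite exprS -ideal_actA IHn ideal_actY exprS mulrA.
Qed.

(** Independence of the Y^i e allows e to be cancelled in X_evalY_e_step. *)
Lemma Xop_mulX_free p : xi (y * p) = yi * (xi p - d *: p + (d * Af p)%:A).
Proof.
apply: evalYe_inj; rewrite -X_evalY_e X_evalY_e_step X_evalY_e evalYM evalYyi -mulrA.
congr (_ * _); move: (d) => d0.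
rewrite evalYD evalYB evalYZ [ev _%:A]evalYZ evalY1 [RHS]mulrDl mulrBl.
by rewrite -!BMW2_scalerAl mul1r.
Qed.

Lemma Xop_y_free : xi y = lambda^-1 *: yi.
Proof.
rewrite -[y in LHS]mulr1 Xop_mulX_free Xop1 efun1 -scalerBl -scalerDl.
by rewrite lambda_inv -scalerAr mulr1.
Qed.

Lemma module_of_independence : exists (V : lmodType B) (v : int -> restr V),
  [/\ forall s : int, v s = act (bYpow k q lambda q_ A s) (v 0),
      is_basis (fun i : 'I_k => v i),
      (forall i : nat, (i.+1 < k)%N -> act Y (v i) = v i.+1)
        /\ act Y (v k.-1) = \sum_(i < k) q_ i *: v i,
      [/\ act X (v 0) = lambda *: v 0,
          act X (v 1) = lambda^-1 *: act Yi (v 0)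
        & forall i : nat, (2 <= i <= k.-1)%N ->
            act X (v i) = act Yi (act X (v i.-1))
              - d *: v (i - 2)%N + (d * A i.-1) *: act Yi (v 0)]
    & forall i : nat, (i < k)%N -> act e (v i) = A i *: v 0].
Proof.
have [V [f [fL fbij actf]]] := ideal_module.
have f_inj := bij_inj fbij.
pose v (s : int) := f (ideal_act (bYpow k q lambda q_ A s) 1).
have vE n : v (Posz n) = f (y ^+ n) by rewrite /v ideal_actYX mulr1.
have v0 : v 0 = f 1 := vE 0%N.
have v1 : v 1 = f y := vE 1%N.
exists V, v; split.
- by move=> s; rewrite v0 actf.
- split=> [c|x].
    under eq_bigr do rewrite vE -fL.2.
    rewrite -(semilin_sum _ _ _ fL) => fc0; apply: S_powers_free; apply: f_inj.
    by rewrite fc0 -[LHS](scale0r (f 0)) -fL.2 scale0r.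
  have [g fK gK] := fbij; exists (fun i => co i (g x)).
  rewrite -{1}[x]gK {1}[g x]co_expand (semilin_sum _ _ _ fL).
  by apply: eq_bigr => i _; rewrite fL.2 vE.
- split=> [i ik|]; first by rewrite !vE actf ideal_actY exprS.
  rewrite vE actf ideal_actY -exprS prednK // y_root (semilin_sum _ _ _ fL).
  by apply: eq_bigr => i _; rewrite fL.2 vE.
- split=> [||i /andP[i2 ik]].
  + by rewrite v0 actf ideal_actX Xop1 fL.2.
  + by rewrite v0 v1 !actf ideal_actX ideal_actYi Xop_y_free mulr1 fL.2.
  rewrite v0 !vE !actf !ideal_actX !ideal_actYi mulr1.
  rewrite -fL.2 -scaleN1r -!fL.2 -!fL.1 scaleN1r; congr (f _).
  have -> : i = i.-2.+2 by lia.
  rewrite exprS Xop_mulX_free subSS subSS subn0 efunX; last by lia.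
  rewrite mulrDr mulrBr -!scalerAr mulr1 [y ^+ i.-2.+1]exprS [yi * (y * _)]mulrA.
  by rewrite [yi * y]mulrC y_inv mul1r.
by move=> i ik; rewrite v0 vE actf ideal_act_e efunX // fL.2.
Qed.

End IdealModule.

(** * The recurrence from a module *)
Section ModuleRecurrence.
Variables (V : lmodType B) (v : int -> restr V).
Hypothesis v_powers : forall s : int, v s = act (bYpow k q lambda q_ A s) (v 0).
Hypothesis v_basis : is_basis (fun i : 'I_k => v i).
Hypothesis Y_v : (forall i : nat, (i.+1 < k)%N -> act Y (v i) = v i.+1)
  /\ act Y (v k.-1) = \sum_(i < k) q_ i *: v i.
Hypothesis X_v : [/\ act X (v 0) = lambda *: v 0,
    act X (v 1) = lambda^-1 *: act Yi (v 0)
  & forall i : nat, (2 <= i <= k.-1)%N ->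
      act X (v i) = act Yi (act X (v i.-1))
        - d *: v (i - 2)%N + (d * A i.-1) *: act Yi (v 0)].
Hypothesis e_v : forall i : nat, (i < k)%N -> act e (v i) = A i *: v 0.

Let vec (p : S) : restr V := lext (fun i => v i) p.

Let vec_semilin : semilin *:%R vec. Proof. exact: lext_semilin. Qed.
Let vecX i : (i < k)%N -> vec (y ^+ i) = v i. Proof. exact: lextX. Qed.
Let vec1 : vec 1 = v 0. Proof. exact: (vecX k_gt0). Qed.

Let actM (x x' : B) (u : restr V) : act x (act x' u) = act (x * x') u.
Proof. by rewrite /act scalerA. Qed.
Let act_semilin (x : B) : semilin *:%R (act x : restr V -> restr V).
Proof.
split=> [u w|r u]; first exact: (scalerDr x (u : V) (w : V)).
change (x *: (r *: (1 : B) *: (u : V)) = r *: (1 : B) *: (x *: (u : V))).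
by rewrite !scalerA -BMW2_scalerAl mul1r -BMW2_scalerAr mulr1.
Qed.
Let actDl (x x' : B) (u : restr V) : act (x + x') u = act x u + act x' u.
Proof. exact: (scalerDl (u : V) x x'). Qed.
Let actZl (r : R) (x : B) (u : restr V) : act (r *: x) u = r *: act x u.
Proof.
change ((r *: x) *: (u : V) = r *: (1 : B) *: (x *: (u : V))).
by rewrite scalerA -BMW2_scalerAl mul1r.
Qed.
Let actNl (x : B) (u : restr V) : act (- x) u = - act x u.
Proof. exact: (scaleNr x (u : V)). Qed.
Let act1 (u : restr V) : act 1 u = u. Proof. exact: (scale1r (u : V)). Qed.

Let vec_inj p p' : vec p = vec p' -> p = p'.
Proof.
move=> pp'; rewrite [p]co_expand [p']co_expand; apply: eq_bigr => i _; congr (_ *: _).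
apply/eqP; rewrite -subr_eq0; apply/eqP; move: i.
apply: v_basis.1; under eq_bigr do rewrite scalerBl.
by rewrite sumrB; apply/eqP; rewrite subr_eq0; apply/eqP.
Qed.

Let Y_vec p : act Y (vec p) = vec (y * p).
Proof.
by rewrite /vec (lext_mulX (f := act Y)) //; [apply: (act_semilin Y).1 | apply: (act_semilin Y).2
  | case: Y_v | case: Y_v].
Qed.

Let Yi_vec p : act Yi (vec p) = vec (yi * p).
Proof. by rewrite -{1}[p]mul1r -y_inv -mulrA -Y_vec actM Yi_Y act1. Qed.

Let x1E : x_ 1 = lambda^-1 *: yi.
Proof. by rewrite /= expr0 -scalerBl -scalerDl lambda_inv -scalerAr mulr1. Qed.

Let X_vec i : (i < k)%N -> act X (vec (y ^+ i)) = vec (x_ i).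
Proof.
have [Xv0 Xv1 Xv2] := X_v.
elim: i => [|[|i] IHi] ik.
- by rewrite expr0 vec1 Xv0 /= vec_semilin.2 vec1.
- by rewrite x1E vec_semilin.2 vecX // Xv1 -vec1 Yi_vec mulr1.
rewrite vecX // Xv2; last by lia.
rewrite -(vecX (ltnW ik)) IHi ?(ltnW ik) // -vec1 !Yi_vec mulr1 subSS subSS subn0.
rewrite -vecX; last by lia.
rewrite -!vec_semilin.2 -scaleN1r -!vec_semilin.2 -!vec_semilin.1 scaleN1r.
congr (vec _); rewrite [RHS]/= -/(Xcoord i.+1) mulrDr mulrBr -!scalerAr mulr1.
by rewrite [y ^+ i.+1]exprS [yi * (y * _)]mulrA [yi * y]mulrC y_inv mul1r.
Qed.

(* The prescribed value of X v_1 makes XYXY fix v_0. *)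
Let C_vec i : (i < k)%N -> act C (vec (y ^+ i)) = vec (y ^+ i).
Proof.
elim: i => [|i IHi] ik.
  have [Xv0 Xv1 _] := X_v.
  rewrite expr0 vec1 -!actM -[act Y (v 0)](v_powers 1) Xv1.
  by rewrite !(act_semilin _).2 (actM Y) Y_Yi act1 Xv0 scalerA mulVr // scale1r.
by rewrite exprS -Y_vec actM -central_Y -actM IHi // ltnW.
Qed.

(** X Y v_(k-1) is the sum of the q_i X v_i, and it is also Y^-1 X^-1 v_(k-1)
    since XYXY acts as 1. *)
Lemma module_recurrence : \sum_(i < k) q_ i *: x_ i = x_ k.
Proof.
have kk : (k.-1 < k)%N by lia.
apply: vec_inj; rewrite (semilin_sum _ _ _ vec_semilin).
transitivity (act X (act Y (vec (y ^+ k.-1)))).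
  rewrite Y_vec -exprS prednK // y_root (semilin_sum _ _ _ vec_semilin).
  rewrite (semilin_sum _ _ _ (act_semilin X)).
  by apply: eq_bigr => i _; rewrite !vec_semilin.2 (act_semilin X).2 X_vec.
transitivity (act Yi (act Xi (vec (y ^+ k.-1)))).
  by rewrite -[in RHS](C_vec kk) !actM !mulrA -[Yi * Xi * X]mulrA Xi_X mulr1 Yi_Y mul1r.
have -> : act Xi (vec (y ^+ k.-1))
    = act X (vec (y ^+ k.-1)) - d *: vec (y ^+ k.-1) + d *: act e (vec (y ^+ k.-1)).
  by rewrite XiE !actDl actNl !actZl act1.
rewrite X_vec // [in act e _]vecX // e_v // -vec1 scalerA -scaleN1r -!vec_semilin.2.
rewrite -!vec_semilin.1 Yi_vec scaleN1r; congr (vec _).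
by rewrite -[in RHS](prednK k_gt0).
Qed.
End ModuleRecurrence.

(** * The equivalences *)
Let card_brick : #|{: 'I_3 * 'I_k * 'I_k}| = (3 * k ^ 2)%N.
Proof. by rewrite !card_prod !card_ord mulnA. Qed.

Lemma free_of_rank_independent :
  free_of_rank B (3 * k ^ 2) -> lin_indep (fun i : 'I_k => Y ^+ i * e).
Proof.
move=> freeB; have [h h_bij] := card_bij card_brick.
have [h' hK h'K] := h_bij.
have b_free : lin_indep (fun i => brick_basis (h i)).
  apply: spanning_lin_indep freeB _ => x; have [c ->] := brick_spanning x.
  by exists (fun i => c (h i)); rewrite (reindex h) //; apply: onW_bij.
have T_free (c : 'I_3 * 'I_k * 'I_k -> R) :
    \sum_t c t *: brick_basis t = 0 -> forall t, c t = 0.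
  rewrite (reindex h); last exact: onW_bij.
  by move=> /b_free c0 t; rewrite -[t]h'K c0.
have eE (i : 'I_k) : Y ^+ i * e = brick_basis (ke, i, Ordinal k_gt0).
  by rewrite /brick_basis /brick /= evalYX // expr0 evalY1 mulr1.
pose h2 (i : 'I_k) := (ke, i, Ordinal k_gt0).
move=> c c0; apply: (@lin_indep_sub _ _ _ _ _ h2 _ T_free) => [i j []//|].
by rewrite -[RHS]c0; apply: eq_bigr => i _; rewrite eE.
Qed.

Lemma recurrence_free_of_rank : \sum_(i < k) q_ i *: x_ i = x_ k ->
  GRing.lreg (delta q) -> free_of_rank B (3 * k ^ 2).
Proof.
move=> x_k d_reg; have [h h_bij] := card_bij card_brick.
exists (fun i => brick_basis (h i)); split=> [|x].
  by apply: lin_indep_sub (bij_inj h_bij) _ => c; apply: brick_basis_free.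
have [c ->] := brick_spanning x; exists (fun i => c (h i)).
by rewrite (reindex h) //; apply: onW_bij.
Qed.

End CyclotomicBMW.

Theorem corollary4p5 (R : comUnitRingType) (k : nat) (q lambda : R)
    (q_ A : nat -> R)
    (k_gt0 : (1 <= k)%N)
    (q_unit : q \is a GRing.unit)
    (lambda_unit : lambda \is a GRing.unit)
    (q0_unit : q_ 0%N \is a GRing.unit)
    (hA0 : lambda - lambda^-1 = delta q * (1 - A 0%N))
    (delta_reg : GRing.lreg (delta q)) :
  let B := BMW2 k q lambda q_ A in
  let Y : B := bY k q lambda q_ A in
  let Yi : B := bYi k q lambda q_ A in
  let X : B := bX k q lambda q_ A in
  let e : B := be k q lambda q_ A in
  [<-> free_of_rank B (3 * k ^ 2);

       lin_indep (fun i : 'I_k => Y ^+ i * e);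

       exists (V : lmodType B) (v : int -> restr V),
         [/\ forall s : int, v s = act (bYpow k q lambda q_ A s) (v 0),
             is_basis (fun i : 'I_k => v i),
             (forall i : nat, (i.+1 < k)%N -> act Y (v i) = v i.+1)
               /\ act Y (v k.-1) = \sum_(i < k) q_ i *: v i,
             [/\ act X (v 0) = lambda *: v 0,
                 act X (v 1) = lambda^-1 *: act Yi (v 0)
               & forall i : nat, (2 <= i <= k.-1)%N ->
                   act X (v i) = act Yi (act X (v i.-1))
                     - delta q *: v (i - 2)%N
                     + (delta q * A i.-1) *: act Yi (v 0)]
           & forall i : nat, (i < k)%N -> act e (v i) = A i *: v 0];

       admissible k q lambda q_ A].
Proof.
move=> B Y Yi X e.
pose f := cyclo_poly k q_.
pose y : {poly %/ f} := in_qpoly f 'X.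
pose co i : {scalar {poly %/ f}} := @cyclo_coef R k q_ i.
have y_root : y ^+ k = \sum_(i < k) q_ i *: y ^+ i by apply: cyclo_root.
have coX i j : (j < k)%N -> co i (y ^+ j) = (i == j)%:R by apply: cyclo_coefX.
have co_expand s : s = \sum_(i < k) co i s *: y ^+ i by apply: cyclo_expand.
have [yi [y_inv _]] : exists yi, y * yi = 1 /\ yi * y = 1.
  apply: (cyclo_inv k_gt0 q0_unit (phi := in_alg {poly %/ f})) => [r s|].
    exact: mulrC.
  by rewrite y_root; apply: eq_bigr => i _; rewrite mulr_algl.
tfae.
- exact: (free_of_rank_independent k_gt0 lambda_unit y_inv y_root coX co_expand).
- exact: (module_of_independence k_gt0 q0_unit lambda_unit hA0 y_inv y_root coX co_expand).
- move=> [V [v [v_powers v_basis Y_v X_v e_v]]].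
  apply/(Xcoord_recurrence_admissible k_gt0 q0_unit lambda_unit hA0 y_inv y_root coX).
  exact: (module_recurrence k_gt0 q0_unit lambda_unit hA0 y_inv y_root coX co_expand
    v_powers v_basis Y_v X_v e_v).
- move/(Xcoord_recurrence_admissible k_gt0 q0_unit lambda_unit hA0 y_inv y_root coX) => x_k.
  exact: (recurrence_free_of_rank k_gt0 q0_unit lambda_unit hA0 y_inv y_root coX co_expand
    x_k delta_reg).
Qed.
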